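(* For every constant $c_1>0$ there exists a constant $c_2>0$ such that the following holds. For any $n\ge2$, any connected graph $G_n=(V_n,E_n)$ on $n$ vertices with maximum degree $\Delta_n$, and any $s>0$ such that $|E_n|\sqrt{s}\le c_1$, $$\mathbb{P}\Big(f_n(\xi_0,\theta)\ne f_n(\xi_0,\theta_s)\Big)\le c_2\,n\,\Delta_n\sqrt{s},$$ where $f_n(\xi_0,\theta)$ is the consensus opinion of the continuous-time voter model on $G_n$ driven by $(\xi_0,\theta)$ and $\theta_s$ is the Brownian perturbation of $\theta$ at noise level $s$.
   Context: Graphs are finite, simple and undirected. $\vec E_n$ denotes the set of directed edges: each $\{x,y\}\in E_n$ gives two directed edges $(x,y)$ and $(y,x)$. Continuous-time voter model. Fix $p\in(0,1)$; the initial configuration $\xi_0\in\{0,1\}^{V_n}$ has i.i.d. Bernoulli($p$) entries. Independently, $\theta=(\omega(k),t(k))_{k\ge1}$, with $0<t(1)<t(2)<\cdots$, is a Poisson point process on $\vec E_n\times\mathbb{R}_+$ with intensity (counting measure)$\,\otimes\,$(Lebesgue measure). At time $t(k)$, if $\omega(k)=(x,y)$, vertex $y$ adopts the current opinion of vertex $x$. Almost surely all opinions eventually agree, and $f_n(\xi_0,\theta)\in\{0,1\}$ is the final common opinion; it depends only on $\xi_0$ and on the ordered sequence of edges $(\omega(k))_{k\ge1}$. Brownian noise. Attach to the points of $\theta$ independent standard Brownian motions $B(k)=(B_s(k))_{s\ge0}$ started at $0$, independent of $(\xi_0,\theta)$. For $s>0$, $\theta_s$ is the configuration obtained from the collection $\{(\omega(k),|t(k)+B_s(k)|):k\ge1\}$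 by reordering it so that the time stamps are in increasing order (i.e. each time stamp moves for time $s$ as an independent Brownian motion reflected at the origin). One has $\theta_s\sim\theta$. *)

(* Defs.v *)
From HB Require Import structures.
From mathcomp Require Import all_boot all_order all_algebra.
From mathcomp Require Import all_classical all_reals all_analysis.
From mathcomp Require Import measurable_realfun.

Set Implicit Arguments.
Unset Strict Implicit.
Unset Printing Implicit Defensive.

Import Order.TTheory GRing.Theory Num.Theory.
Import numFieldNormedType.Exports.

Record sgraph (V : finType) := SGraph {
  adj : rel V;
  adj_sym : symmetric adj;
  adj_irrefl : irreflexive adj }.

Section Graph.
Context {V : finType} (G : sgraph V).

Definition connected_graph : Prop := forall x y : V, connect (adj G) x y.

Definition edges : {set {set V}} :=
  ([set e : {set V} | [exists x : V, exists y : V,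
                         adj G x y && (e == [set x; y])]])%SET.

Definition degree (x : V) : nat := #|adj G x|.

Definition max_degree : nat := \max_(x : V) degree x.

Definition dedge := {e : V * V | adj G e.1 e.2}.

End Graph.

Local Open Scope classical_set_scope.
Local Open Scope ring_scope.

(* A configuration is a sequence of time-stamped directed edges.  The opinion
   of the tail x of an edge (x, y) is copied to its head y. *)
Section VoterModel.
Context {R : realType} {V : finType} {G : sgraph V}.
Implicit Types (xi : V -> bool) (theta : nat -> dedge G * R).

Definition voter_step xi (e : dedge G) : V -> bool :=
  fun v => if v == (val e).2 then xi (val e).1 else xi v.

Fixpoint voter xi theta (k : nat) : V -> bool :=
  if k is k'.+1 then voter_step (voter xi theta k') (theta k').1 else xi.

(* The default [false] is only used when the opinions never agree, an event of
   probability zero in the model below. *)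
Definition consensus xi theta : bool :=
  xget false [set b : bool | \forall k \near \oo,
                               forall v, voter xi theta k v = b].

(* The enumeration of [theta] by increasing time stamps is unique when it
   exists; if there is none (a null event below) [theta] is left unchanged. *)
Definition reorder theta : nat -> dedge G * R :=
  theta \o xget (idfun : nat -> nat) [set sigma : nat -> nat |
    bijective sigma /\
    {homo (fun k => (theta (sigma k)).2) : i j / (i < j)%N >-> i < j}].

End VoterModel.

Section Probability.
Local Open Scope ereal_scope.
Context {R : realType} {d : measure_display} {T : measurableType d}.
Variable P : probability T R.

Definition mutually_independent (I : eqType) (F : I -> set (set T)) : Prop :=
  forall (J : seq I) (A : I -> set T), uniq J ->
    (forall i, i \in J -> F i (A i)) ->
    P (\big[setI/setT]_(i <- J) A i) = \prod_(i <- J) P (A i).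

Definition independent2 (F1 F2 : set (set T)) : Prop :=
  forall A1 A2, F1 A1 -> F2 A2 -> P (A1 `&` A2) = P A1 * P A2.

(* The sigma-algebra generated by the maps [X i], [i] in [D], with values in a
   space whose measurable sets are [M]. *)
Definition sigma_of (I U : Type) (M : set (set U)) (D : set I)
    (X : I -> T -> U) : set (set T) :=
  <<s \bigcup_(i in D) preimage_set_system setT (X i) M >>.

Definition has_law {d' : measure_display} {U : measurableType d'}
    (X : T -> U) (mu : set U -> \bar R) : Prop :=
  forall A, measurable A -> P (X @^-1` A) = mu A.

(* Pitfall: the second argument of [normal_prob] is the standard deviation. *)
Record standard_brownian (B : R -> T -> R) : Prop := StandardBrownian {
  brownian_measurable : forall t : R, (0 <= t)%R -> measurable_fun setT (B t);
  brownian_start : {ae P, forall w, B 0%R w = 0%R};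
  brownian_increment : forall s t : R, (0 <= s < t)%R ->
    has_law (B t \- B s)%R (normal_prob 0 (Num.sqrt (t - s)));
  brownian_independent : forall t : nat -> R, (0 <= t 0%N)%R ->
    {homo t : i j / (i <= j)%N >-> (i <= j)%R} ->
    mutually_independent (fun i : nat =>
      sigma_of measurable setT (fun _ : unit => (B (t i.+1) \- B (t i))%R));
  brownian_continuous :
    {ae P, forall w, {within `[0%R, +oo[, continuous (fun t => B t w)}} }.

Context {V : finType} {G : sgraph V}.

(* Product of the discrete sigma-algebra on the finite set of directed edges
   and of the Borel sigma-algebra. *)
Definition marked_measurable : set (set (dedge G * R)) :=
  [set A | forall e, measurable (xsection A e)].

(* counting measure (x) Lebesgue measure on directed edges x R_+ *)
Definition intensity (A : set (dedge G * R)) : \bar R :=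
  \sum_(e : dedge G) lebesgue_measure (xsection A e `&` `[0%R, +oo[).

Definition point_count (theta : nat -> T -> dedge G * R)
    (A : set (dedge G * R)) (w : T) : \bar R :=
  counting [set k | A (theta k w)].

(* Pitfall: the second argument of [poisson_prob] is a dummy. *)
Record poisson_process (theta : nat -> T -> dedge G * R) : Prop :=
  PoissonProcess {
  poisson_measurable : forall k A, marked_measurable A ->
    measurable (theta k @^-1` A);
  poisson_ordered : {ae P, forall w, (0 < (theta 0%N w).2)%R /\
    (forall k, ((theta k w).2 < (theta k.+1 w).2)%R)};
  poisson_law : forall A, marked_measurable A -> intensity A < +oo ->
    forall m : nat, P [set w | point_count theta A w = m%:R%:E] =
                    poisson_prob (fine (intensity A)) 0%N [set m];
  poisson_independent : forall A : nat -> set (dedge G * R),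
    (forall i, marked_measurable (A i)) -> trivIset setT A ->
    mutually_independent (fun i : nat =>
      sigma_of measurable setT
        (fun _ : unit => point_count theta (A i))) }.

Definition perturb (theta : nat -> T -> dedge G * R) (B : nat -> R -> T -> R)
    (s : R) (w : T) : nat -> dedge G * R :=
  reorder (fun k => ((theta k w).1, `|(theta k w).2 + B k s w|%R)).

Definition sigma_init (xi : V -> T -> bool) : set (set T) :=
  sigma_of measurable setT xi.

Definition sigma_points (theta : nat -> T -> dedge G * R) : set (set T) :=
  sigma_of marked_measurable setT theta.

Definition sigma_path (B : R -> T -> R) : set (set T) :=
  sigma_of measurable [set t : R | (0 <= t)%R] B.

Record noisy_voter_model (p : R) (xi : V -> T -> bool)
    (theta : nat -> T -> dedge G * R) (B : nat -> R -> T -> R) : Prop :=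
  NoisyVoterModel {
  init_measurable : forall v, measurable_fun setT (xi v);
  init_law : forall v, has_law (xi v) (bernoulli_prob p);
  init_independent : mutually_independent (fun v : V =>
    sigma_of measurable setT (fun _ : unit => xi v));
  points_poisson : poisson_process theta;
  init_points_independent : independent2 (sigma_init xi) (sigma_points theta);
  noise_brownian : forall k, standard_brownian (B k);
  noise_independent : mutually_independent (fun k => sigma_path (B k));
  noise_rest_independent : independent2
    <<s \bigcup_k sigma_path (B k) >>
    <<s sigma_init xi `|` sigma_points theta >> }.

End Probability.

(* Main.v *)
Require Import Defs.
From HB Require Import structures.
From mathcomp Require Import all_boot all_order all_algebra.
From mathcomp Require Import all_classical all_reals all_analysis.
From mathcomp Require Import measurable_realfun.
From mathcomp Require Import zify ring lra.

Set Implicit Arguments.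
Unset Strict Implicit.
Unset Printing Implicit Defensive.

Import Order.TTheory GRing.Theory Num.Theory.
Import numFieldNormedType.Exports.

Local Open Scope classical_set_scope.
Local Open Scope ring_scope.

(* The marks omega(k) are independent, uniform and independent of the time
   stamps and of the noise, hence of the order of the points in theta_s.  For a
   fixed order, theta is turned into theta_s by insertion sort, i.e. by adjacent
   transpositions.  If the swapped edges are at positions q and q+1, the two runs
   can only differ when the edges share a vertex and one of them joins different
   opinions at step q; afterwards the number of disagreeing vertices is a
   martingale, so the swap changes the winner with probability at most
   12 Delta H_q / (n m^2), where m is the number of directed edges and H_q the
   mean number of discordant ones at step q, starting from distinct opinions.
   The number of ordered pairs of agreeing vertices is at most n^2 and increases
   on average by 2 H_q / m at each step, so the sum of the H_q is at most m n^2 / 2.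
   The number of swaps at position q is at most the number of pairs l <= q < k
   whose order is reversed by the noise.  As t(k) - t(l) is a sum of k - l
   exponential times of rate m and the displacements have Gaussian tails on the
   scale sqrt s, the reversal has probability O(rho^(k-l)) with
   rho = m sqrt s / (1 + m sqrt s), whence O(m sqrt s) swaps at each position.
   The product of the three estimates is O(n Delta sqrt s) if m sqrt s <= 1; as
   m <= n Delta, the statement is trivial otherwise. *)

(** * Voter model along a list of edges *)

(** Starting from [id] makes a run record the vertex from which each opinion stems. Since runs
    commute with maps of opinions, one estimate then serves every initial configuration: equal
    winning vertices give equal outcomes. When both runs have a winner and the winners differ, all n
    vertices disagree, so Markov's inequality gains the factor 1 / n over the mean number of
    disagreements.

    The obstacle is that infinitely many points have to be sorted. Only the first L + 1 are, and
    only the first J steps of both runs have to be decisive. For fixed J the head of the sorted list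
    stabilises as L grows; the swap bound does not depend on L because the H_q are summable; lack of
    a winner after J steps costs O(1 / J). So L goes to infinity first and J afterwards.

    The Poisson process is given by its counts only, whereas the argument speaks of enumerated
    points. Grids of mesh 1 / (N + 1) translate between the two up to null sets: for small mesh the
    relevant points lie in distinct cells, and an event about enumerated points becomes one about
    counts in boxes. *)

Section VoterRuns.
Context {V : finType} {G : sgraph V}.
Local Open Scope nat_scope.
Implicit Types (e : dedge G) (ws : seq (dedge G)).

Definition source e : V := (val e).1.
Definition target e : V := (val e).2.

Definition rev_dedge e : dedge G :=
  exist (fun e : V * V => adj G e.1 e.2) (target e, source e)
    (etrans (adj_sym G (target e) (source e)) (valP e)).

Lemma rev_dedgeK : involutive rev_dedge.
Proof. by move=> [[x y] xy]; exact/val_inj. Qed.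

(** Every edge occurs in both directions, so source and target of a uniform edge have the same law;
    both one-step identities below rest on this cancellation. *)
Lemma sum_rev (d : dedge G -> nat) :
  \sum_(e : dedge G) d (rev_dedge e) = \sum_(e : dedge G) d e.
Proof. by rewrite [RHS](reindex_inj (inv_inj rev_dedgeK)). Qed.

Lemma sum_dedge_const c : \sum_(e : dedge G) c = #|{: dedge G}| * c.
Proof. exact: sum_nat_const. Qed.

Lemma card_target (y : V) : #|[pred e | target e == y]| <= max_degree G.
Proof.
have -> : #|[pred e | target e == y]| = #|[seq source e | e in [pred e | target e == y]]|.
  apply/esym/card_in_image => -[[a b] ab] [[a' b'] ab'].
  rewrite !inE /source /target /= => /eqP by_ /eqP b'y aa'.
  by apply/val_inj; rewrite /= aa' by_ b'y.
apply: (@leq_trans (degree G y)); last exact: (leq_bigmax (F := degree G)).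
apply: subset_leq_card; apply/fintype.subsetP => x /fintype.imageP[[[a b] ab]].
by rewrite !inE /target /source /= => /eqP <- ->; rewrite -topredE /= adj_sym.
Qed.

Lemma card_source (y : V) : #|[pred e | source e == y]| <= max_degree G.
Proof.
rewrite -sum1_card (reindex_inj (inv_inj rev_dedgeK)) /=.
rewrite sum1_card; exact: card_target.
Qed.

Lemma card_dedge_le : #|{: dedge G}| <= #|V| * max_degree G.
Proof.
rewrite -sum1_card (partition_big target predT) //=.
rewrite -sum_nat_const; apply: leq_sum => y _.
by rewrite sum1_card; exact: card_target.
Qed.

(** Updates are precompositions with a map of vertices: they make sense for opinions in any type and
    commute with maps between such types. *)
Definition origin e (v : V) : V := if v == target e then source e else v.

Definition step {A : Type} (z : V -> A) e : V -> A := z \o origin e.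
Definition run {A : Type} (z : V -> A) ws : V -> A := foldl step z ws.

Lemma run_cat {A : Type} (z : V -> A) ws ws' :
  run z (ws ++ ws') = run (run z ws) ws'.
Proof. exact: foldl_cat. Qed.

Lemma run_comp {A B : Type} (f : A -> B) (z : V -> A) ws :
  run (f \o z) ws = f \o run z ws.
Proof. by elim: ws z => //= e ws IH z; rewrite -IH. Qed.

(** The value at the target is lost and that at the source counted once more; the additive form
    avoids truncated subtraction. *)
Lemma sum_upd (d : V -> nat) e :
  \sum_v d (origin e v) + d (target e) = \sum_v d v + d (source e).
Proof.
rewrite (bigD1 (target e)) //= [in RHS](bigD1 (target e)) //= {1}/origin eqxx.
rewrite (eq_bigr d); first lia.
by move=> v /negPf vy; rewrite /origin vy.
Qed.

Section Disagreement.
Context {A : eqType}.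
Implicit Types z : V -> A.

Definition disagreements z z' : nat := \sum_v (z v != z' v).

Lemma disagreements_tri z2 z1 z3 :
  disagreements z1 z3 <= disagreements z1 z2 + disagreements z2 z3.
Proof.
rewrite -big_split; apply: leq_sum => v _ /=.
by have [->|] := eqVneq (z1 v) (z2 v); rewrite ?add0n //=; case: (_ != _); lia.
Qed.

(** The martingale property, times the number of edges. With a common edge the disagreement
    indicator is itself copied from source to target, and gains and losses cancel by [sum_rev]. *)
Lemma disagreements_step z z' :
  \sum_e disagreements (step z e) (step z' e) =
  #|{: dedge G}| * disagreements z z'.
Proof.
pose d v : nat := z v != z' v.
have E : \sum_e (disagreements (step z e) (step z' e) + d (target e)) =
   \sum_e (disagreements z z' + d (source e)).
  by apply: eq_bigr => e _; exact: (sum_upd d e).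
rewrite !big_split /= sum_dedge_const in E.
have F : \sum_e d (target e) = \sum_e d (source e) := sum_rev (fun e => d (source e)).
by apply/eqP; rewrite -(eqn_add2r (\sum_e d (target e))) E -F.
Qed.

Definition discordant z e : bool := z (source e) != z (target e).
Definition discord z : nat := \sum_e discordant z e.
Definition agreeing_pairs z : nat := \sum_u \sum_v (z u == z v).

(** If n(x) vertices agree with x, copying x to y changes the count by 2 (n(x) - n(y)), plus 2 if x
    and y disagreed, since y still agrees with itself. The differences cancel over reversed
    edges. *)
Lemma agreeing_pairs_step z :
  \sum_e agreeing_pairs (step z e) =
  #|{: dedge G}| * agreeing_pairs z + 2 * discord z.
Proof.
pose n x := \sum_v (z x == z v).
have E e : agreeing_pairs (step z e) + (n (target e) + n (target e)) =
    agreeing_pairs z + (n (source e) + n (source e)) + (discordant z e + discordant z e).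
  have E1 u := sum_upd (fun v => (z (origin e u) == z v : nat)) e.
  have : \sum_u (\sum_v (z (origin e u) == z (origin e v)) +
      (z (origin e u) == z (target e))) =
    \sum_u (\sum_v (z (origin e u) == z v) + (z (origin e u) == z (source e))).
    by apply: eq_bigr => u _; exact: E1.
  rewrite !big_split /=.
  have E2 := sum_upd (fun u => (z u == z (target e) : nat)) e.
  have E3 := sum_upd (fun u => (z u == z (source e) : nat)) e.
  have E4 := sum_upd (fun u => \sum_v (z u == z v)) e.
  have nE x : \sum_u (z u == z x) = n x by apply: eq_bigr => u _; rewrite eq_sym.
  rewrite !nE /= !eqxx in E2 E3 E4.
  rewrite -/(n _) -/(n _) in E4.
  rewrite (eq_sym (z (target e))) in E3.
  rewrite /agreeing_pairs /discordant -/(agreeing_pairs z) in E4 *.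
  move: E2 E3 E4; set g := (z (source e) == _); case: g => /=; rewrite /step /=; lia.
have : \sum_e (agreeing_pairs (step z e) + (n (target e) + n (target e))) =
  \sum_e (agreeing_pairs z + (n (source e) + n (source e)) + (discordant z e + discordant z e)).
  by apply: eq_bigr => e _; exact: E.
rewrite !big_split /= sum_dedge_const.
have F : \sum_e n (target e) = \sum_e n (source e) := sum_rev (fun e => n (source e)).
rewrite /discord F; move: (_ * agreeing_pairs z) (\sum_e n (source e)).
move: (\sum_e nat_of_bool _) (\sum_e agreeing_pairs _) => a b c d; lia.
Qed.

Lemma agreeing_pairs_le z : agreeing_pairs z <= #|V| ^ 2.
Proof.
rewrite -mulnn -sum_nat_const; apply: leq_sum => u _.
by rewrite -sum1_card; apply: leq_sum => v _; exact: leq_b1.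
Qed.

(** Edges that only share their source do not count: neither writes a vertex that the other reads or
    writes. *)
Definition conflict e e' : bool :=
  [|| target e == target e', source e == target e' | target e == source e'].

Lemma conflict_sym : symmetric conflict.
Proof.
move=> e e'; rewrite /conflict (eq_sym (target e')) (eq_sym (source e')).
by rewrite (eq_sym (target e') (source e)); case: eqP => //=; rewrite orbC.
Qed.

Lemma card_conflict e : \sum_e' conflict e e' <= 3 * max_degree G.
Proof.
have -> : 3 * max_degree G = max_degree G + (max_degree G + max_degree G) by lia.
have H a : \sum_e' (a == target e') <= max_degree G.
  apply: leq_trans (card_target a); rewrite -sum1_card [leqRHS]big_mkcond /=.
  by apply: leq_sum => e' _; rewrite inE eq_sym; case: eqP.
have H' a : \sum_e' (a == source e') <= max_degree G.
  apply: leq_trans (card_source a); rewrite -sum1_card [leqRHS]big_mkcond /=.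
  by apply: leq_sum => e' _; rewrite inE eq_sym; case: eqP.
apply: leq_trans (leq_add (H (target e)) (leq_add (H (source e)) (H' (target e)))).
rewrite -!big_split /=; apply: leq_sum => e' _.
by rewrite /conflict; do 3 case: (_ == _).
Qed.

Lemma step_id z e : ~~ discordant z e -> step z e =1 z.
Proof.
by rewrite negbK => /eqP E v; rewrite /step /= /origin; case: eqP => [->|].
Qed.

(** Two concordant edges do nothing in either order, and otherwise only the two targets can be
    affected, whence the factor 2. *)
Lemma swap_disagreements_pair z e e' :
  disagreements (run z [:: e; e']) (run z [:: e'; e]) <=
  2 * (conflict e e' * (discordant z e + discordant z e')).
Proof.
have [c|nc] := boolP (conflict e e'); last first.
  rewrite /disagreements big1 // => v _; apply/eqP; rewrite eqb0 negbK.
  move: nc; rewrite /conflict !negb_or => /and3P[/negPf h1 /negPf h2 /negPf h3].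
  rewrite /run /step /origin /=; apply/eqP; congr z.
  have h1' : (target e' == target e) = false by rewrite eq_sym.
  have h3' : (source e' == target e) = false by rewrite eq_sym.
  case: (eqVneq v (target e')) => [->|/negPf nv] /=.
    by do 3 rewrite ?(h1, h1', h2, h3', eqxx) //=.
  by case: (eqVneq v (target e)) => _ /=; rewrite ?h2 // nv.
have [d|] := boolP (discordant z e || discordant z e'); last first.
  rewrite negb_or => /andP[d d'].
  rewrite /disagreements big1 // => v _; apply/eqP; rewrite eqb0 negbK /=.
  have E f f' u : ~~ discordant z f -> ~~ discordant z f' ->
     step (step z f) f' u = z u.
    by move=> /step_id h /step_id h'; rewrite {1}/step /= h -[RHS]h'.
  by rewrite !E.
apply: (@leq_trans 2); last by move: d; do 2 case: (discordant _ _).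
have -> : 2 = 1 + 1 by [].
apply: (@leq_trans (\sum_v ((v == target e) + (v == target e')))); last first.
  have one a : \sum_(v : V) (v == a) <= 1.
    by rewrite (bigD1 a) //= eqxx big1 // => v /negPf ->.
  by rewrite big_split /=; apply: leq_add.
apply: leq_sum => v _; rewrite /run /step /origin /=.
case: (eqVneq v (target e)) => [_|/negPf nv].
  by rewrite add1n (leq_trans (leq_b1 _)).
case: (eqVneq v (target e')) => [_|/negPf nv'] /=.
  by rewrite add0n leq_b1.
by rewrite nv eqxx.
Qed.

(** The constant is 2 (3 + 3): an edge conflicts with at most 3 Delta edges, and either edge of the
    pair may be the discordant one. *)
Lemma swap_disagreements z :
  \sum_e \sum_e' disagreements (run z [:: e; e']) (run z [:: e'; e]) <=
  12 * max_degree G * discord z.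
Proof.
apply: (@leq_trans (\sum_e \sum_e'
   (2 * (conflict e e' * (discordant z e + discordant z e'))))).
  by apply: leq_sum => e _; apply: leq_sum => e' _; exact: swap_disagreements_pair.
have H : \sum_e \sum_e' (conflict e e' * discordant z e) <=
    3 * max_degree G * discord z.
  rewrite /discord big_distrr /=; apply: leq_sum => e _.
  by rewrite -big_distrl /= leq_mul2r card_conflict orbT.
have H' : \sum_e \sum_e' (conflict e e' * discordant z e') <=
    3 * max_degree G * discord z.
  rewrite exchange_big /=; apply: leq_trans H.
  apply: leq_sum => e _; apply: leq_sum => e' _.
  by rewrite conflict_sym.
have -> : \sum_e \sum_e' 2 * (conflict e e' * (discordant z e + discordant z e'))
  = 2 * (\sum_e \sum_e' (conflict e e' * discordant z e) +
         \sum_e \sum_e' (conflict e e' * discordant z e')).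
  rewrite -big_split big_distrr /=; apply: eq_bigr => e _.
  by rewrite -big_split big_distrr /=; apply: eq_bigr => e' _; rewrite mulnDr.
by apply: (@leq_trans (2 * (3 * max_degree G * discord z +
   3 * max_degree G * discord z))); [rewrite leq_mul2l leq_add | lia].
Qed.

Definition unanimous z : bool := [forall u, forall v, z u == z v].

Lemma unanimousP z : reflect (forall u v, z u = z v) (unanimous z).
Proof.
apply: (iffP forallP) => [h u v|h u]; first by apply/eqP; move/forallP: (h u).
by apply/forallP => v; apply/eqP.
Qed.

Lemma unanimous_run z ws : unanimous z -> run z ws =1 z.
Proof.
move=> /unanimousP h; elim: ws z h => //= e ws IH z h v.
by rewrite IH /step //=.
Qed.

Lemma unanimous_run_in z ws : unanimous z -> unanimous (run z ws).
Proof.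
move=> h; apply/unanimousP => u v.
by rewrite !unanimous_run //; exact/unanimousP.
Qed.

Lemma discord_gt0 z : connected_graph G -> ~~ unanimous z -> 0 < discord z.
Proof.
move=> cG; apply: contraNT; rewrite -leqNgt leqn0 sum_nat_eq0 => /forallP h.
apply/unanimousP => u v.
have /connectP[p pp ->] := cG u v; elim: p u pp => //= x p IH u /andP[ux /IH <-].
have := h (exist (fun e : V * V => adj G e.1 e.2) (u, x) ux).
by rewrite /discordant /source /target /= eqb0 negbK => /eqP.
Qed.

End Disagreement.
End VoterRuns.

(** * Averages over independent uniform edges *)

Section UniformEdges.
Context {R : realFieldType} {V : finType} {G : sgraph V}.
Implicit Types (e : dedge G) (ws : seq (dedge G)) (F : seq (dedge G) -> R).

Local Notation m := (#|{: dedge G}|%:R : R).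

(** An iterated average, so that a list can be split at any position; [mean_tuple] identifies it
    with the uniform law on tuples. *)
Fixpoint mean (n : nat) (F : seq (dedge G) -> R) : R :=
  if n is n'.+1 then m^-1 * \sum_(e : dedge G) mean n' (fun ws => F (e :: ws))
  else F [::].

Lemma eq_mean n F F' : (forall ws, size ws = n -> F ws = F' ws) ->
  mean n F = mean n F'.
Proof.
elim: n F F' => /= [|n IH] F F' h; first exact: h.
by congr (_ * _); apply: eq_bigr => e _; apply: IH => ws s; rewrite h //= s.
Qed.

Lemma le_mean n F F' : (forall ws, size ws = n -> F ws <= F' ws) ->
  mean n F <= mean n F'.
Proof.
elim: n F F' => /= [|n IH] F F' h; first exact: h.
rewrite ler_wpM2l ?invr_ge0 //; apply: ler_sum => e _.
by apply: IH => ws s; rewrite h //= s.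
Qed.

Lemma meanD n F F' : mean n (fun ws => F ws + F' ws) = mean n F + mean n F'.
Proof.
elim: n F F' => //= n IH F F'; rewrite -mulrDr -big_split; congr (_ * _).
by apply: eq_bigr => e _; rewrite IH.
Qed.

Lemma meanZ n c F : mean n (fun ws => c * F ws) = c * mean n F.
Proof.
elim: n F => //= n IH F; rewrite mulrCA; congr (_ * _).
by rewrite mulr_sumr; apply: eq_bigr => e _; rewrite IH.
Qed.

Lemma mean_cat a b F :
  mean (a + b) F = mean a (fun u => mean b (fun v => F (u ++ v))).
Proof.
elim: a F => //= a IH F; congr (_ * _); apply: eq_bigr => e _.
by rewrite IH.
Qed.

Lemma mean_tuple n F :
  mean n F = m^-1 ^+ n * \sum_(t : n.-tuple (dedge G)) F t.
Proof.
elim: n F => [|n IH] F.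
  rewrite expr0 mul1r (bigD1 [tuple]) //= big1 ?addr0 // => t.
  by rewrite (tuple0 t) => /eqP.
rewrite /= exprS -mulrA; congr (_ * _).
have h : bijective (fun x : dedge G * n.-tuple (dedge G) => [tuple of x.1 :: x.2]).
  exists (fun t => (thead t, [tuple of behead t])) => [[e t]|t] /=.
    by congr pair; exact/val_inj.
  by case/tupleP: t => e t; apply/val_inj; rewrite /= theadE.
rewrite (reindex _ (onW_bij _ h)) /=.
rewrite -(pair_bigA _ (fun e (t : n.-tuple _) => F (e :: t))) /= mulr_sumr.
by apply: eq_bigr => e _; rewrite IH.
Qed.

(** A fixed permutation of the positions permutes the tuples, so a uniform list stays uniform when
    read in any fixed order. *)
Lemma mean_perm n (l : seq nat) (e0 : dedge G) F :
  perm_eq l (iota 0 n) ->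
  mean n (fun ws => F [seq nth e0 ws i | i <- l]) = mean n F.
Proof.
move=> pl; rewrite !mean_tuple; congr (_ * _).
have sl : size l = n by rewrite (perm_size pl) size_iota.
have sh (t : n.-tuple (dedge G)) : size [seq nth e0 t i | i <- l] == n.
  by rewrite size_map sl.
pose h (t : n.-tuple (dedge G)) : n.-tuple (dedge G) := Tuple (sh t).
have ih : injective h.
  move=> t t' /(congr1 val) /= /eq_in_map tt'; apply/val_inj/(@eq_from_nth _ e0).
    by rewrite !size_tuple.
  move=> i; rewrite size_tuple => ni; apply: tt'.
  by rewrite (perm_mem pl) mem_iota.
by rewrite [RHS](reindex_inj ih).
Qed.

Hypothesis m_gt0 : 0 < m.

Lemma mean_cst n c : mean n (fun=> c) = c.
Proof.
elim: n c => //= n IH c; under eq_bigr do rewrite IH.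
by rewrite sumr_const -(mulr_natr c) mulrCA mulVf ?mulr1 // gt_eqF.
Qed.

Lemma mean_disagreements {A : eqType} n (z z' : V -> A) :
  mean n (fun ws => (disagreements (run z ws) (run z' ws))%:R) =
  (disagreements z z')%:R.
Proof.
elim: n z z' => //= n IH z z'; under eq_bigr do rewrite IH.
rewrite -natr_sum disagreements_step natrM mulKf //.
by rewrite gt_eqF.
Qed.

Definition mean_discord {A : eqType} (z : V -> A) q : R :=
  mean q (fun ws : seq (dedge G) => (discord (G := G) (run z ws))%:R).

(* The mean of [agreeing_pairs] starts nonnegative, gains [2 / m] times
   [mean_discord] at each step and stays below [#|V| ^ 2]. *)
Lemma sum_mean_discord {A : eqType} (z : V -> A) k :
  \sum_(q < k) mean_discord z q <= m * (#|V| ^ 2)%:R / 2.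
Proof.
pose S q := mean q (fun ws : seq (dedge G) => (agreeing_pairs (run z ws))%:R : R).
have SS q : S q.+1 = S q + m^-1 * (2 * mean_discord z q).
  rewrite /S -addn1 mean_cat /mean_discord -!meanZ -meanD.
  apply: eq_mean => ws _ /=; under eq_bigr do rewrite run_cat /=.
  rewrite -natr_sum agreeing_pairs_step natrD !natrM mulrDr mulKf //.
  by rewrite gt_eqF.
have Sk : S k = S 0%N + m^-1 * (2 * \sum_(q < k) mean_discord z q).
  elim: k => [|k IH]; first by rewrite big_ord0 !mulr0 addr0.
  by rewrite SS IH big_ord_recr /=; ring.
have S0 : 0 <= S 0%N by rewrite /S.
have Skle : S k <= (#|V| ^ 2)%:R.
  rewrite -(mean_cst k (#|V| ^ 2)%:R); apply: le_mean => ws _.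
  by rewrite ler_nat agreeing_pairs_le.
have h : m^-1 * (2 * \sum_(q < k) mean_discord z q) <= (#|V| ^ 2)%:R.
  by rewrite (le_trans _ Skle) // Sk lerDr.
rewrite ler_pdivlMr // [leLHS]mulrC -ler_pdivrMl //.
Qed.

(** A run without a winner at step [J] has none at an earlier step [q] either, hence a discordant
    edge there by connectedness. Adding this up over [q] bounds [J] times the probability by the
    total mean discord. *)
Lemma mean_not_unanimous {A : eqType} (z : V -> A) J : connected_graph G ->
  mean J (fun ws : seq (dedge G) => (~~ unanimous (run z ws))%:R) * J%:R
    <= m * (#|V| ^ 2)%:R / 2.
Proof.
move=> cG; apply: le_trans (sum_mean_discord z J).
rewrite mulr_natr -[X in _ *+ X]card_ord -sumr_const.
apply: ler_sum => q _.
move: (nat_of_ord q) (ltnW (ltn_ord q)) => {}q qJ.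
rewrite -(subnKC qJ) mean_cat /mean_discord.
apply: le_mean => ws _; rewrite -[leRHS](mean_cst (J - q)).
apply: le_mean => ws' _; rewrite ler_nat run_cat.
have [u|/(discord_gt0 cG)] := boolP (unanimous (run z ws)); last first.
  by apply: leq_trans; rewrite leq_b1.
by rewrite unanimous_run_in.
Qed.

(** Given the first [q] edges, the swap creates few disagreements, and the remaining edges preserve
    their mean number. The value 0 is a dummy: the lists have length [q + 2 + r]. *)
Lemma mean_swap {A : eqType} (z : V -> A) q r :
  mean (q + 2 + r) (fun ws => if drop q ws is e :: e' :: ws' then
     (disagreements (run z ws) (run z (take q ws ++ e' :: e :: ws')))%:R else 0)
  <= 12 * (max_degree G)%:R / m ^+ 2 * mean_discord z q.
Proof.
rewrite /mean_discord -addnA mean_cat -meanZ; apply: le_mean => u su.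
rewrite mean_cat /=.
under eq_bigr => e _ do under eq_bigr => e' _ do
  under eq_mean => w _ do
    rewrite drop_size_cat // take_size_cat // !run_cat /= -!/(run _ _).
under eq_bigr => e _ do under eq_bigr => e' _ do rewrite mean_disagreements.
under eq_bigr => e _ do rewrite -natr_sum.
rewrite -mulr_sumr -natr_sum mulrA -invfM -expr2.
rewrite [leRHS]mulrAC [leRHS]mulrC ler_wpM2l ?invr_ge0 ?exprn_ge0 //.
by rewrite -!natrM ler_nat; exact: swap_disagreements.
Qed.

End UniformEdges.

(** * Cost of reordering the edges *)

Section InsertionSort.
Implicit Types (r : rel nat) (s : seq nat).

(** Filtering instead of searching makes sorting a permutation for any relation [r]; on a sorted
    list the two filters are a prefix and a suffix. *)
Definition insert_last r k s :=
  [seq i <- s | r i k] ++ k :: [seq i <- s | ~~ r i k].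

Fixpoint isort r k : seq nat :=
  if k is k'.+1 then insert_last r k' (isort r k') else [::].

Lemma perm_isort r k : perm_eq (isort r k) (iota 0 k).
Proof.
elim: k => [//|k IH].
have -> : iota 0 k.+1 = rcons (iota 0 k) k by rewrite -addn1 iotaD cats1.
rewrite /= /insert_last perm_catC /= perm_sym perm_rcons perm_cons perm_sym.
by rewrite perm_catC (permPl (permEl (perm_filterC _ _))).
Qed.

Lemma mem_isort r k i : (i \in isort r k) = (i < k)%N.
Proof. by rewrite (perm_mem (perm_isort r k)) mem_iota. Qed.

Lemma isort_uniq r k : uniq (isort r k).
Proof. by rewrite (perm_uniq (perm_isort r k)) iota_uniq. Qed.

Lemma size_isort r k : size (isort r k) = k.
Proof. by rewrite (perm_size (perm_isort r k)) size_iota. Qed.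

(** Sorting depends on finitely many comparisons only, which later reduces a random order to a
    random boolean matrix. *)
Lemma eq_isort r r' k :
  (forall i j, (i < k)%N -> (j < k)%N -> r i j = r' i j) -> isort r k = isort r' k.
Proof.
elim: k => //= k IH h; rewrite -IH; last first.
  by move=> i j ik jk; apply: h; rewrite ltnS ltnW.
rewrite /insert_last; congr (_ ++ _ :: _); apply: eq_in_filter => i.
  by rewrite mem_isort => ik; rewrite h // ltnW.
by rewrite mem_isort => ik; rewrite h // ltnW.
Qed.

(** By transitivity, nothing after the first element not below [k] is below [k]; so inserting [k]
    moves it across one contiguous block. *)
Lemma sorted_filter_split r k s : transitive r -> sorted r s ->
  s = [seq i <- s | r i k] ++ [seq i <- s | ~~ r i k].
Proof.
move=> tr; elim: s => // x s IH /= xs.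
have [xk|nxk] /= := boolP (r x k); first by rewrite -IH // (path_sorted xs).
have H : {in s, forall y, ~~ r y k}.
  move=> y ys; apply: contra nxk => yk; apply: (tr y) yk.
  by move/(order_path_min tr)/allP: xs; apply.
have -> : [seq i <- s | r i k] = [::].
  by apply/eqP; rewrite -(negbK (_ == _)) -has_filter; apply/hasPn.
by congr (_ :: _); apply/esym/all_filterP/allP.
Qed.

Lemma isort_sorted r k : transitive r -> total r -> sorted r (isort r k).
Proof.
move=> tr to; elim: k => //= k IH; rewrite /insert_last.
rewrite (sorted_pairwise tr) pairwise_cat /= -!(sorted_pairwise tr).
have h1 : all (r k) [seq i <- isort r k | ~~ r i k].
  apply/allP => y; rewrite mem_filter => /andP[/negPf yk _].
  by case/orP: (to k y) => //; rewrite yk.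
rewrite h1 !(sorted_filter tr) // !andbT.
apply/allrelP => x y; rewrite mem_filter inE => /andP[xk _].
by case/orP => [/eqP -> //|/(allP h1)]; exact: tr.
Qed.

End InsertionSort.

Section SortingCost.
Context {R : realFieldType} {V : finType} {G : sgraph V} (e0 : dedge G).
Local Notation m := (#|{: dedge G}|%:R : R).
Hypothesis m_gt0 : 0 < m.

Definition mean_diff (n : nat) (h h' : seq nat) : R :=
  mean n (fun ws => (disagreements (run id [seq nth e0 ws i | i <- h])
                                   (run id [seq nth e0 ws i | i <- h']))%:R).

Definition swap_cost (q : nat) : R :=
  12 * (max_degree G)%:R / m ^+ 2 * mean_discord (G := G) id q.

Lemma swap_cost_ge0 q : 0 <= swap_cost q.
Proof.
rewrite /swap_cost !mulr_ge0 ?invr_ge0 ?exprn_ge0 //.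
by rewrite -(mean_cst m_gt0 q 0); exact: le_mean.
Qed.

Lemma mean_diff_tri n h2 h1 h3 :
  mean_diff n h1 h3 <= mean_diff n h1 h2 + mean_diff n h2 h3.
Proof.
rewrite -meanD; apply: le_mean => ws _; rewrite -natrD ler_nat.
exact: disagreements_tri.
Qed.

(** Read in the order [p ++ x :: y :: r], the list is again uniform, and the two swapped edges start
    at position [size p]. *)
Lemma mean_diff_swap n p x y r : perm_eq (p ++ x :: y :: r) (iota 0 n) ->
  mean_diff n (p ++ x :: y :: r) (p ++ y :: x :: r) <= swap_cost (size p).
Proof.
move=> pn; rewrite /swap_cost; apply: le_trans (mean_swap m_gt0 id _ (size r)).
have -> : (size p + 2 + size r)%N = n.
  by have := perm_size pn; rewrite size_iota size_cat /=; lia.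
rewrite -(mean_perm e0 _ pn) le_eqVlt; apply/orP; left; apply/eqP.
apply: eq_mean => ws _; rewrite !map_cat /=.
by rewrite drop_size_cat ?size_map // take_size_cat ?size_map.
Qed.

Lemma mean_diff_move n a b k r : perm_eq (a ++ b ++ k :: r) (iota 0 n) ->
  mean_diff n (a ++ b ++ k :: r) (a ++ k :: b ++ r) <=
  \sum_(size a <= q < size a + size b) swap_cost q.
Proof.
elim: b a => [|x b IH] a pn /=.
  rewrite addn0 big_geq // /mean_diff -[leRHS](mean_cst m_gt0 n 0).
  apply: le_mean => ws _; rewrite /disagreements big1 // => v _.
  by rewrite eqxx.
(* [k] first passes the rest of the block, with [x] counted as part of [a], and then [x] itself by
   the swap at position [size a]. *)
apply: le_trans (mean_diff_tri _ (a ++ x :: k :: (b ++ r)) _ _) _.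
rewrite addnS big_ltn; last by rewrite ltnS leq_addr.
rewrite [leRHS]addrC lerD //.
  rewrite -!(cat_rcons x a) -addSn -(size_rcons a x).
  by apply: IH; rewrite cat_rcons.
apply: mean_diff_swap; rewrite -(permPr pn) perm_cat2l /= perm_cons perm_sym.
by rewrite -[k :: r]/([:: k] ++ r) perm_catCA.
Qed.

(* The insertion of [k] uses a swap at position [q] only if [k] overtakes more
   than [k - q.+1] smaller indices, hence at least one [l <= q]. *)
Lemma mean_diff_isort n (r : rel nat) : transitive r -> total r ->
  mean_diff n (iota 0 n) (isort r n) <=
  \sum_(q < n) swap_cost q *
    \sum_(k < n) \sum_(l < n) (((l <= q < k)%N && ~~ r l k)%:R).
Proof.
move=> tr to.
pose b k := [seq i <- isort r k | ~~ r i k].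
have bk k : (size (b k) <= k)%N.
  by rewrite -[leqRHS](size_isort r k) size_filter count_size.
(* After [k] insertions the other indices are still in place; inserting [j] carries it past the last
   [size (b j)] sorted indices, through swaps at the positions [j - size (b j)] to [j - 1]. *)
have main k : (k <= n)%N -> mean_diff n (iota 0 n) (isort r k ++ iota k (n - k)) <=
    \sum_(j < k) \sum_(j - size (b j) <= q < j) swap_cost q.
  elim: k => [_|k IH kn].
    rewrite big_ord0 subn0 /mean_diff -[leRHS](mean_cst m_gt0 n 0).
    apply: le_mean => ws _; rewrite /disagreements big1 // => v _.
    by rewrite eqxx.
  rewrite big_ord_recr /=.
  apply: le_trans (mean_diff_tri _ (isort r k ++ iota k (n - k)) _ _) _.
  apply: lerD; first exact/IH/ltnW.
  have E : iota k (n - k) = k :: iota k.+1 (n - k.+1).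
    by rewrite -[RHS]/(iota k (n - k.+1).+1) subnSK.
  have sp := sorted_filter_split k tr (isort_sorted k tr to).
  rewrite {1}sp E /insert_last -!catA cat_cons.
  have sa : size [seq i <- isort r k | r i k] = (k - size (b k))%N.
    have := congr1 size sp; rewrite size_cat size_isort /b; lia.
  have sb : k = (size [seq i <- isort r k | r i k] + size (b k))%N.
    by rewrite sa subnK.
  rewrite -sa [X in \sum_(_ <= q < X) _]sb.
  apply: mean_diff_move; rewrite catA -sp -E.
  by rewrite -[X in iota 0 X](subnKC (ltnW kn)) iotaD perm_cat2r perm_isort.
have := main n (leqnn n); rewrite subnn cats0 => /le_trans; apply.
under [leRHS]eq_bigr do rewrite mulr_sumr.
rewrite [leRHS]exchange_big /=; apply: ler_sum => j _.
rewrite (big_nat_widenl _ 0) // (big_nat_widen _ _ n) ?(ltnW (ltn_ord j)) //.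
rewrite big_mkord big_mkcond; apply: ler_sum => q _.
case: ifPn => [/andP[bq qj]|_]; last by rewrite mulr_ge0 ?swap_cost_ge0 ?sumr_ge0.
rewrite ler_peMr ?swap_cost_ge0 //.
have /hasP[l lb lq] : has (fun l => (l <= q)%N) (b j).
  apply/negPn/negP => /hasPn h.
  have /uniq_leq_size : uniq (b j) by rewrite filter_uniq ?isort_uniq.
  move=> /(_ (iota q.+1 (j - q.+1))); rewrite size_iota => hs.
  have {hs} : (size (b j) <= j - q.+1)%N.
    apply: hs => l lb; rewrite mem_iota.
    move: (lb); rewrite mem_filter mem_isort => /andP[_ lj].
    have := h l lb; lia.
  move: bq (bk j) qj; lia.
move: lb; rewrite mem_filter mem_isort => /andP[rlj lj].
rewrite (bigD1 (Ordinal (ltn_trans lj (ltn_ord j)))) //= lq qj rlj /=.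
by rewrite lerDl sumr_ge0.
Qed.

End SortingCost.

(** * Different winners under a reordering *)

Section Reordering.
Context {R : realFieldType} {V : finType} {G : sgraph V} (e0 : dedge G).
Local Notation m := (#|{: dedge G}|%:R : R).
Hypothesis m_gt0 : 0 < m.
Implicit Types (ws : seq (dedge G)) (h : seq nat).

(* Meaningful for [J <= size ws]: outside this event, both orders have produced
   a winner, the same one, within [J] steps. *)
Definition may_differ (J : nat) ws h : bool :=
  let ws' := [seq nth e0 ws i | i <- h] in
  [|| ~~ unanimous (run (id : V -> V) (take J ws)),
      ~~ unanimous (run (id : V -> V) (take J ws')) |
      disagreements (run (id : V -> V) ws) (run id ws') != 0%N].

Lemma mean_not_unanimous_take J n : (J <= n)%N ->
  mean n (fun ws => (~~ unanimous (run (id : V -> V) (take J ws)))%:R) =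
  mean J (fun ws => (~~ unanimous (run (id : V -> V) ws))%:R) :> R.
Proof.
move=> Jn; rewrite -(subnKC Jn) mean_cat; apply: eq_mean => u su.
under eq_mean do rewrite take_size_cat //.
by rewrite mean_cst.
Qed.

(** The reordered list is uniform too, which doubles the first term. If both runs are unanimous with
    different winners, all vertices disagree, and Markov's inequality gives the factor
    [#|V|%:R^-1]. *)
Lemma mean_may_differ J n h : (J <= n)%N -> perm_eq h (iota 0 n) ->
  mean n (fun ws => (may_differ J ws h)%:R : R) <=
  2 * mean J (fun ws => (~~ unanimous (run (id : V -> V) ws))%:R) +
  #|V|%:R^-1 * mean_diff e0 n (iota 0 n) h.
Proof.
move=> Jn hn.
pose u ws := (~~ unanimous (run (id : V -> V) (take J ws)))%:R : R.
have -> : 2 * mean J (fun ws => (~~ unanimous (run (id : V -> V) ws))%:R) =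
  mean n u + mean n (fun ws => u [seq nth e0 ws i | i <- h]).
  by rewrite mean_perm // mean_not_unanimous_take //; ring.
rewrite -meanD -meanZ -meanD; apply: le_mean => ws sw.
have -> : [seq nth e0 ws i | i <- iota 0 n] = ws.
  by rewrite -sw; exact: (mkseq_nth e0 ws).
rewrite /may_differ /u; set ws' := [seq _ | i <- h].
have V0 : 0 <= #|V|%:R^-1 :> R by rewrite invr_ge0.
have d0 : 0 <= #|V|%:R^-1 * (disagreements (run id ws) (run id ws'))%:R :> R.
  by rewrite mulr_ge0.
have [c1|c1] := boolP (unanimous _); last by rewrite /=; case: (~~ _) => /=; lra.
have [c2|c2] := boolP (unanimous _); last by rewrite /=; lra.
rewrite /= !add0r.
have {}c1 : unanimous (run id ws).
  by rewrite -(cat_take_drop J ws) run_cat unanimous_run_in.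
have {}c2 : unanimous (run id ws').
  by rewrite -(cat_take_drop J ws') run_cat unanimous_run_in.
have [_|nz] := eqVneq; first by rewrite mulr_ge0.
have : exists v, run id ws v != run id ws' v.
  apply/existsP; apply: contraNT nz; rewrite negb_exists => /forallP h0.
  by rewrite /disagreements big1 // => v _; apply/eqP; rewrite eqb0.
case=> v nv; rewrite /disagreements.
under eq_bigr => u' _.
  rewrite (unanimousP _ c1 u' v) (unanimousP _ c2 u' v) nv; over.
rewrite sum1_card mulVf // pnatr_eq0 -lt0n; apply/card_gt0P.
by exists v.
Qed.

End Reordering.

(** * Measurability and probability *)

Section MeasurablePredicates.
Context {d : measure_display} {T : measurableType d}.

(** Measurability of an event given as a predicate, to be proved along its connectives and countable
    quantifiers. *)
Definition mpred (Q : T -> Prop) : Prop := measurable [set w | Q w].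

Lemma mpred_and Q1 Q2 : mpred Q1 -> mpred Q2 -> mpred (fun w => Q1 w /\ Q2 w).
Proof. exact: measurableI. Qed.

Lemma mpred_or Q1 Q2 : mpred Q1 -> mpred Q2 -> mpred (fun w => Q1 w \/ Q2 w).
Proof. exact: measurableU. Qed.

Lemma mpred_not Q : mpred Q -> mpred (fun w => ~ Q w).
Proof. exact: measurableC. Qed.

Lemma mpred_cst (X : Prop) : mpred (fun=> X).
Proof.
rewrite /mpred; have [x|x] := pselect X.
  have -> : [set _ : T | X] = setT by apply/seteqP; split.
  exact: measurableT.
have -> : [set _ : T | X] = set0 by apply/seteqP; split.
exact: measurable0.
Qed.

Lemma eq_mpred Q1 Q2 : (forall w, Q1 w <-> Q2 w) -> mpred Q1 -> mpred Q2.
Proof.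
move=> h; rewrite /mpred [X in measurable X -> _](_ : _ = [set w | Q2 w]) //.
by apply/seteqP; split => w /= /h.
Qed.

Lemma mpred_imp (X : Prop) Q : mpred Q -> mpred (fun w => X -> Q w).
Proof.
move=> mQ; apply: (@eq_mpred (fun w => ~ X \/ Q w)).
  by move=> w; split; [case | have [x /(_ x)|] := pselect X; [right|left]].
by apply: mpred_or => //; exact: mpred_cst.
Qed.

Lemma mpred_existsn (Q : nat -> T -> Prop) :
  (forall n, mpred (Q n)) -> mpred (fun w => exists n, Q n w).
Proof.
move=> mQ; rewrite /mpred [X in measurable X](_ : _ = \bigcup_n [set w | Q n w]).
  exact: bigcupT_measurable.
by apply/seteqP; split => w /=; [case=> n Qn; exists n | case=> n _ Qn; exists n].
Qed.

Lemma mpred_foralln (Q : nat -> T -> Prop) :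
  (forall n, mpred (Q n)) -> mpred (fun w => forall n, Q n w).
Proof.
move=> mQ; rewrite /mpred [X in measurable X](_ : _ = \bigcap_n [set w | Q n w]).
  exact: bigcapT_measurable.
by apply/seteqP; split => w /= h n; [move=> _; exact: h | exact: h].
Qed.

Lemma mpred_exists_fin (I : finType) (Q : I -> T -> Prop) :
  (forall i, mpred (Q i)) -> mpred (fun w => exists i, Q i w).
Proof.
move=> mQ; rewrite /mpred [X in measurable X](_ : _ = \bigcup_i [set w | Q i w]).
  by apply: fin_bigcup_measurable => [|i _]; [exact: finite_finset | exact: mQ].
by apply/seteqP; split => w /=; [case=> n Qn; exists n | case=> n _ Qn; exists n].
Qed.

Lemma mpred_forall_fin (I : finType) (Q : I -> T -> Prop) :
  (forall i, mpred (Q i)) -> mpred (fun w => forall i, Q i w).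
Proof.
move=> mQ; rewrite /mpred [X in measurable X](_ : _ = \bigcap_i [set w | Q i w]).
  by apply: fin_bigcap_measurable => [|i _]; [exact: finite_finset | exact: mQ].
by apply/seteqP; split => w /= h n; [move=> _; exact: h | exact: h].
Qed.

Definition mfin {F : Type} (Y : T -> F) : Prop := forall y, mpred (fun w => Y w = y).

Lemma mfin_pred (F : finType) (Y : T -> F) (Q : F -> Prop) :
  mfin Y -> mpred (fun w => Q (Y w)).
Proof.
move=> mY; apply: (@eq_mpred (fun w => exists y, Q y /\ Y w = y)).
  by move=> w; split => [[y [Qy ->]]//|QY]; exists (Y w).
by apply: mpred_exists_fin => y; apply: mpred_and => //; exact: mpred_cst.
Qed.

Lemma mfin_pair (F F' : Type) (Y : T -> F) (Y' : T -> F') :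
  mfin Y -> mfin Y' -> mfin (fun w => (Y w, Y' w)).
Proof.
move=> mY mY' [y y']; apply: (@eq_mpred (fun w => Y w = y /\ Y' w = y')).
  by move=> w; split => [[-> ->]//|[-> ->]].
exact: mpred_and.
Qed.

Lemma mfin_ffun (I : finType) (F : Type) (Y : I -> T -> F) :
  (forall i, mfin (Y i)) -> mfin (fun w => [ffun i => Y i w]).
Proof.
move=> mY f; apply: (@eq_mpred (fun w => forall i, Y i w = f i)).
  move=> w; split => [h|<- i]; last by rewrite ffunE.
  by apply/ffunP => i; rewrite ffunE.
by apply: mpred_forall_fin => i; exact: mY.
Qed.

Lemma mfin_bool (b : T -> bool) : mpred (fun w => b w) -> mfin b.
Proof.
move=> mb [|]; first exact: mb.
apply: (@eq_mpred (fun w => ~ b w)); last exact: mpred_not.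
by move=> w; split => [/negP/negPf//|->].
Qed.

Lemma mpred_le {R : realType} (f g : T -> R) :
  measurable_fun setT f -> measurable_fun setT g -> mpred (fun w => f w <= g w).
Proof.
move=> mf mg.
have := measurable_funB mf mg measurableT (measurable_itv `]-oo, 0]).
by rewrite setTI; apply: eq_mpred => w; rewrite /= in_itv /= subr_le0.
Qed.

Lemma mpred_lt {R : realType} (f g : T -> R) :
  measurable_fun setT f -> measurable_fun setT g -> mpred (fun w => f w < g w).
Proof.
move=> mf mg; apply: eq_mpred (mpred_not (mpred_le mg mf)) => w.
by rewrite ltNge; split => /negP.
Qed.

End MeasurablePredicates.

Section RealProbability.
Context {R : realType} {d : measure_display} {T : measurableType d}.
Variable P : probability T R.
Implicit Types A B : set T.

Definition pr A : R := fine (P A).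

Lemma prE A : measurable A -> P A = (pr A)%:E.
Proof. by move=> mA; rewrite /pr fineK // fin_num_measure. Qed.

Lemma pr_ge0 A : 0 <= pr A.
Proof. by rewrite /pr fine_ge0. Qed.

Lemma pr_le A B : measurable A -> measurable B -> A `<=` B -> pr A <= pr B.
Proof.
move=> mA mB AB; rewrite -lee_fin -!prE //.
by apply: le_measure => //; rewrite inE.
Qed.

Lemma pr_setT : pr setT = 1.
Proof. by rewrite /pr probability_setT. Qed.

Lemma pr_set0 : pr set0 = 0.
Proof. by rewrite /pr measure0. Qed.

Lemma pr_le1 A : measurable A -> pr A <= 1.
Proof. by move=> mA; rewrite -pr_setT; apply: pr_le. Qed.

Lemma prU_le A B : measurable A -> measurable B -> pr (A `|` B) <= pr A + pr B.
Proof.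
move=> mA mB; rewrite -lee_fin EFinD -!prE //; last exact: measurableU.
exact: measureU2.
Qed.

Lemma pr_setD A B : measurable A -> measurable B -> B `<=` A ->
  pr (A `\` B) = pr A - pr B.
Proof.
move=> mA mB BA; apply: EFin_inj; rewrite EFinB -!prE //; last exact: measurableD.
rewrite measureD // ?setIidr //.
by rewrite ltey_eq fin_num_measure.
Qed.

Lemma pr_bigcup_fin (I : finType) (A : I -> set T) :
  (forall i, measurable (A i)) -> trivIset setT A ->
  pr (\bigcup_i A i) = \sum_i pr (A i).
Proof.
move=> mA tA; apply: EFin_inj; rewrite -sumEFin -prE; last first.
  by apply: fin_bigcup_measurable => [|i _]; [exact: finite_finset|].
under eq_bigr do rewrite -prE //.
rewrite measure_fin_bigcup //; last exact: finite_finset.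
rewrite (@bigfs _ _ _ _ (index_enum I) xpredT) ?index_enum_uniq //; last first.
  by move=> i _; rewrite mem_index_enum.
by apply: eq_fsbigl; apply/seteqP; split.
Qed.

Lemma pr_partition (F : finType) (Y : T -> F) A : measurable A -> mfin Y ->
  pr A = \sum_y pr (A `&` [set w | Y w = y]).
Proof.
move=> mA mY; rewrite -pr_bigcup_fin.
- by congr pr; apply/seteqP; split => [w Aw|w [y _ []//]]; exists (Y w).
- by move=> y; apply: measurableI => //; exact: mY.
- by move=> y y' _ _ [w [[_ /= <-] [_ /= <-]]].
Qed.

Lemma pr_ae (Q : T -> Prop) A B : {ae P, forall w, Q w} ->
  measurable A -> measurable B -> (forall w, Q w -> A w -> B w) -> pr A <= pr B.
Proof.
move=> [N [mN N0 QN]] mA mB AB.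
apply: (@le_trans _ _ (pr (B `|` N))).
  apply: pr_le => //; first exact: measurableU.
  by move=> w Aw; have [q|nq] := pselect (Q w); [left; exact: AB | right; exact: QN].
apply: (le_trans (prU_le mB mN)).
have -> : pr N = 0 by rewrite /pr N0.
by rewrite addr0.
Qed.

Lemma pr_ae_eq (Q : T -> Prop) A B : {ae P, forall w, Q w} ->
  measurable A -> measurable B -> (forall w, Q w -> (A w <-> B w)) -> pr A = pr B.
Proof.
move=> aeQ mA mB AB; apply/eqP; rewrite eq_le.
by apply/andP; split; apply: (pr_ae aeQ) => // w /AB[].
Qed.

(** A form of Fatou's lemma: [B] is covered by the increasing events [L M], and [L n] is contained
    in [A n]. The limits in the mesh and in the number of points go through it. *)
Lemma pr_liminf (A : nat -> set T) B (b : R) : measurable B ->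
  (forall n, measurable (A n)) ->
  (forall w, B w -> exists M, forall n, (M <= n)%N -> A n w) ->
  (exists M, forall n, (M <= n)%N -> pr (A n) <= b) -> pr B <= b.
Proof.
move=> mB mA BA [M0 Ab].
pose L M := \bigcap_(n in [set n | (M <= n)%N]) A n.
have mL M : measurable (L M) by apply: bigcap_measurableType => n _.
have mU : measurable (\bigcup_M L M) by exact: bigcupT_measurable.
have ndL : nondecreasing_seq L.
  by move=> i j ij; apply/subsetPset => w Lw n /= jn; apply: Lw; exact: leq_trans jn.
have cv := nondecreasing_cvg_mu (mu := P) mL mU ndL.
rewrite -lee_fin -prE //.
apply: (@le_trans _ _ (P (\bigcup_M L M))).
  apply: le_measure; rewrite ?inE // => w /BA[M AM]; exists M => //.
rewrite -(cvg_lim _ cv) //; apply: lime_le; first by apply/cvg_ex; eexists; exact: cv.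
near=> n => /=; rewrite prE // lee_fin.
have nM : (M0 <= n)%N by near: n; exact: nbhs_infty_ge.
apply: le_trans (Ab n nM); apply: pr_le => // w; apply; exact: leqnn.
Unshelve. all: by end_near.
Qed.

Lemma prU_sigma_le (A : nat -> set T) B (c : R) : measurable B ->
  (forall n, measurable (A n)) -> B `<=` \bigcup_n A n ->
  (forall n, pr (A n) <= c / (2 ^ n.+1)%:R) -> 0 <= c -> pr B <= c.
Proof.
move=> mB mA BA Ac c0; rewrite -lee_fin -prE //.
have := measure_sigma_subadditive P mA mB BA => /le_trans; apply.
apply: (le_trans _ (epsilon_trick0 xpredT c0)).
apply: lee_nneseries => // n _; by rewrite -[leLHS]/(P (A n)) (prE (mA n)) lee_fin Ac.
Qed.

End RealProbability.

(** * Marks and times of the Poisson process *)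

Section PoissonPoints.
Context {R : realType} {d : measure_display} {T : measurableType d}.
Context (P : probability T R) {V : finType} {G : sgraph V}.
Context (theta : nat -> T -> dedge G * R) (theta_poisson : poisson_process P theta).

Definition slab (Q : pred (dedge G)) (I : set R) : set (dedge G * R) :=
  [set z | Q z.1 /\ I z.2].

Lemma xsection_slab Q I e : xsection (slab Q I) e = if Q e then I else set0.
Proof.
apply/seteqP; split => y; rewrite /xsection /= ?inE /slab /=.
  by case=> ->.
by case: ifP.
Qed.

Lemma slab_measurable Q I : measurable I -> marked_measurable (slab Q I).
Proof. by move=> mI e /=; rewrite xsection_slab; case: ifP. Qed.

Lemma slab_intensity Q I (l : R) : I `<=` `[0, +oo[ -> lebesgue_measure I = l%:E ->
  intensity (slab Q I) = (#|Q|%:R * l)%:E.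
Proof.
move=> I0 Il; rewrite /intensity.
under eq_bigr do rewrite xsection_slab.
rewrite (eq_bigr (fun e => (if Q e then l else 0)%:E)).
  by rewrite sumEFin -big_mkcond /= sumr_const mulr_natl.
by move=> e _; case: ifP => _; rewrite setIidl // measure0.
Qed.

Lemma measurable_point k (Q : pred (dedge G)) (I : set R) : measurable I ->
  mpred (fun w => Q (theta k w).1 /\ I (theta k w).2).
Proof.
by move=> mI; have := poisson_measurable theta_poisson k (slab_measurable Q mI).
Qed.

Lemma mfin_edge k : mfin (fun w => (theta k w).1).
Proof.
move=> e; apply: eq_mpred (measurable_point k (pred1 e) measurableT) => w.
by split => [[/eqP //]|/eqP].
Qed.

Lemma measurable_time k : measurable_fun setT (fun w => (theta k w).2).
Proof.
move=> _ I mI; rewrite setTI.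
by apply: eq_mpred (measurable_point k predT mI) => w; split => [[]|].
Qed.

Definition ordered_at (w : T) : Prop := 0 < (theta 0 w).2 /\
  forall k, (theta k w).2 < (theta k.+1 w).2.

Lemma ordered_lt w : ordered_at w ->
  {homo (fun k => (theta k w).2) : i j / (i < j)%N >-> i < j}.
Proof. by move=> [_ h]; apply: homo_ltn h; exact: lt_trans. Qed.

Lemma ordered_ltE w i j : ordered_at w ->
  ((theta i w).2 < (theta j w).2) = (i < j)%N.
Proof.
move=> ow; have [ij|ji|->] := ltngtP i j; last by rewrite ltxx.
  exact: ordered_lt.
by apply/negbTE; rewrite -leNgt ltW // ordered_lt.
Qed.

Lemma ordered_gt0 w k : ordered_at w -> 0 < (theta k w).2.
Proof. by case=> h0 h; elim: k => // k; move/lt_trans; apply. Qed.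

Lemma count_eq0 (S : set nat) : counting S = 0%:R%:E :> \bar R -> S = set0.
Proof.
rewrite /counting; case: asboolP => // fS [] /eqP.
rewrite pnatr_eq0 finmap.cardfs_eq0 => /eqP S0.
by rewrite -(fset_setK fS) S0; apply/seteqP; split => x //=.
Qed.

Lemma count_eq1 (S : set nat) : counting S = 1%:R%:E :> \bar R -> exists j, S = [set j].
Proof.
rewrite /counting; case: asboolP => // fS [] /eqP.
rewrite eqr_nat => /finmap.cardfs1P[j Sj]; exists j.
by rewrite -(fset_setK fS) Sj; apply/seteqP; split => x /=; rewrite inE => /eqP.
Qed.

Lemma count_set0 : counting (set0 : set nat) = 0%:R%:E :> \bar R.
Proof. by rewrite measure0. Qed.

Lemma count_set1 (j : nat) : counting [set j] = 1%:R%:E :> \bar R.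
Proof. by rewrite /counting asboolT // fset_set1 finmap.cardfs1. Qed.

Lemma count_iota (S : set nat) a j : (forall i, (a <= i < a + j)%N -> S i) ->
  (j%:R%:E <= counting S :> \bar R)%E.
Proof.
move=> h; rewrite /counting; case: asboolP => fS; last by rewrite leey.
rewrite lee_fin ler_nat -(size_iota a j).
apply: uniq_leq_size; first exact: iota_uniq.
by move=> i; rewrite mem_iota in_fset_set // inE => /h.
Qed.

Lemma count_le_iota (S : set nat) j : (forall i, S i -> (i < j)%N) ->
  (counting S <= j%:R%:E :> \bar R)%E.
Proof.
move=> h; have fS : finite_set S.
  by apply: (sub_finite_set (B := `I_j)) => //; exact: finite_II.
rewrite /counting asboolT // lee_fin ler_nat -[leqRHS](size_iota 0 j).
apply: uniq_leq_size; first exact: finmap.fset_uniq.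
by move=> i; rewrite in_fset_set // inE mem_iota => /h.
Qed.

End PoissonPoints.

(** * Enumerated points and counts in grid cells *)

Section Grid.
Context {R : realType} {d : measure_display} {T : measurableType d}.
Context (P : probability T R) {V : finType} {G : sgraph V}.
Context (theta : nat -> T -> dedge G * R) (theta_poisson : poisson_process P theta).
Context (delta : R) (delta_gt0 : 0 < delta).

Definition cell (x : nat) : set R := `[x%:R * delta, x.+1%:R * delta[%classic.

Lemma cellP x t : cell x t <-> x%:R * delta <= t < x.+1%:R * delta.
Proof. by rewrite /cell /= in_itv. Qed.

Lemma cell_le x y t : cell x t -> t < y%:R * delta -> (x < y)%N.
Proof.
move=> /cellP/andP[xt _] ty.
by have := le_lt_trans xt ty; rewrite ltr_pM2r // ltr_nat.
Qed.

Lemma cell_ge x y t : cell x t -> y%:R * delta <= t -> (y <= x)%N.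
Proof.
move=> /cellP/andP[_ xt] ty.
by have := le_lt_trans ty xt; rewrite ltr_pM2r // ltr_nat.
Qed.

Lemma cell_inj x y t : cell x t -> cell y t -> x = y.
Proof.
move=> cx cy; apply/eqP; rewrite eqn_leq.
have /cellP/andP[xt _] := cx; have /cellP/andP[yt _] := cy.
by rewrite (cell_ge cx yt) (cell_ge cy xt).
Qed.

Lemma cell_exists t : 0 <= t -> exists x, cell x t.
Proof.
move=> t0; exists (Num.trunc (t / delta)); apply/cellP.
have /truncn_itv : 0 <= t / delta by rewrite divr_ge0 // ltW.
by rewrite ler_pdivlMr // ltr_pdivrMr.
Qed.

Lemma cell_ge0 x : cell x `<=` `[0, +oo[.
Proof.
move=> t /cellP/andP[xt _]; rewrite /= in_itv /= andbT.
by apply: le_trans xt; rewrite mulr_ge0 // ltW.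
Qed.

Lemma cell_length x : lebesgue_measure (cell x) = delta%:E.
Proof.
rewrite /cell lebesgue_measure_itv /= lte_fin ltr_pM2r // ltr_nat ltnSn.
by rewrite -EFinB -mulrBl -natrB // subSnn mul1r.
Qed.

Definition box (e : dedge G) (x : nat) : set (dedge G * R) :=
  slab (pred1 e) (cell x).

Lemma box_measurable e x : marked_measurable (box e x).
Proof. by apply: slab_measurable; exact: measurable_itv. Qed.

Lemma box_inj e x e' x' z : box e x z -> box e' x' z -> (e, x) = (e', x').
Proof. by case=> /eqP <- cx [/eqP <- cx']; rewrite (cell_inj cx cx'). Qed.

Lemma pr_count_box e x n :
  P [set w | point_count theta (box e x) w = n%:R%:E] = poisson_prob delta 0%N [set n].
Proof.
have I1 : intensity (box e x) = delta%:E.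
  rewrite (slab_intensity _ (@cell_ge0 x) (cell_length x)).
  by rewrite cardE enum1 mul1r.
rewrite (poisson_law theta_poisson) ?I1 ?ltry //; exact: box_measurable.
Qed.

Section Event.
Context {L : nat} (e : 'I_L.+1 -> dedge G) (c : 'I_L.+1 -> nat).
Hypothesis c_lt : {homo c : i j / (i < j)%N >-> (i < j)%N}.

(** The bound on point [L.+1] excludes further points up to the end of the last cell; with it the
    event is determined by the counts in finitely many boxes. *)
Definition grid_event : set T := [set w |
  (forall k : 'I_L.+1, (theta k w).1 = e k /\ cell (c k) (theta k w).2) /\
  (c ord_max).+1%:R * delta <= (theta L.+1 w).2].

(** As the cells [c k] are distinct, a box holds at most one of the prescribed points; hence a truth
    value read as a number. *)
Definition mark_count (e' : dedge G) (x : nat) : nat :=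
  [exists k, (c k == x) && (e k == e')].

Definition count_event : set T := [set w | forall x, (x < (c ord_max).+1)%N ->
  forall e', point_count theta (box e' x) w = (mark_count e' x)%:R%:E].

Lemma c_le : {homo c : i j / (i <= j)%N >-> (i <= j)%N}.
Proof.
move=> i j; rewrite leq_eqVlt => /orP[/eqP/val_inj -> //|ij].
exact/ltnW/c_lt.
Qed.

Lemma c_inj : injective c.
Proof.
move=> i j cij; case: (ltngtP i j) => [/c_lt|/c_lt|/val_inj //].
  by rewrite cij ltnn.
by rewrite cij ltnn.
Qed.

Lemma grid_count w : ordered_at theta w -> grid_event w -> count_event w.
Proof.
move=> ow [h hL] x xM e'; rewrite /point_count.
have jL j : box e' x (theta j w) -> (j < L.+1)%N.
  move=> [_ cx]; rewrite ltnNge; apply/negP => Lj.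
  have : (theta L.+1 w).2 <= (theta j w).2.
    by rewrite leNgt (ordered_ltE _ _ ow) -leqNgt.
  move=> /(le_trans hL)/(cell_ge cx); rewrite leqNgt.
  by rewrite xM.
have bE j (jl : (j < L.+1)%N) :
    box e' x (theta j w) <-> c (Ordinal jl) = x /\ e (Ordinal jl) = e'.
  have [/= te tc] := h (Ordinal jl); rewrite /box /slab /= te.
  split => [[/eqP -> cx]|[<- <-]]; last by rewrite eqxx.
  by rewrite (cell_inj tc cx).
rewrite /mark_count; case: existsP => [[k /andP[/eqP ck /eqP ek]]|nk].
  rewrite [X in counting X](_ : _ = [set (k : nat)]); first exact: count_set1.
  apply/seteqP; split => [j bj|_ /= ->]; last first.
    by apply/(bE _ (ltn_ord k)); rewrite (_ : Ordinal _ = k) //; exact/val_inj.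
  have := bj => /(bE _ (jL _ bj))[cj _]; rewrite /= -[j]/(val (Ordinal (jL _ bj))).
  by congr val; apply: c_inj; rewrite cj ck.
rewrite [X in counting X](_ : _ = set0); first exact: count_set0.
apply/seteqP; split => [j bj|//]; have := bj => /(bE _ (jL _ bj))[cj ej].
by apply: nk; exists (Ordinal (jL _ bj)); rewrite cj ej !eqxx.
Qed.

(** The boxes with count one give points [j k] increasing in [k], and by the zero counts no other
    point precedes the end of the last cell. So the [j k] fill an initial segment. *)
Lemma count_grid w : ordered_at theta w -> count_event w -> grid_event w.
Proof.
move=> ow h.
have cM k : (c k < (c ord_max).+1)%N by rewrite ltnS c_le // -ltnS.
have jex k : exists j, box (e k) (c k) (theta j w).
  have := h (c k) (cM k) (e k); rewrite /mark_count (_ : [exists _, _]); last first.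
    by apply/existsP; exists k; rewrite !eqxx.
  by case/count_eq1 => j Sj; exists j; have : [set j] j by []; rewrite -Sj.
have [j jP] := fin_all_exists jex.
have jlt (k k' : 'I_L.+1) : (k < k')%N -> (j k < j k')%N.
  move=> kk'; rewrite -(ordered_ltE _ _ ow).
  have [_ /cellP/andP[_ h1]] := jP k; have [_ /cellP/andP[h2 _]] := jP k'.
  apply: lt_le_trans h1 (le_trans _ h2).
  by rewrite ler_pM2r // ler_nat; exact: c_lt.
have jle (k k' : 'I_L.+1) : (k <= k')%N -> (j k <= j k')%N.
  by rewrite leq_eqVlt => /orP[/eqP/val_inj -> //|/jlt/ltnW].
have jsurj i : (theta i w).2 < (c ord_max).+1%:R * delta -> exists k, i = j k.
  move=> ti; have [x cx] := cell_exists (ltW (ordered_gt0 i ow)).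
  have xM := cell_le cx ti.
  have bi : box (theta i w).1 x (theta i w) by split => //=.
  have := h x xM (theta i w).1; rewrite /mark_count.
  case: existsP => [[k /andP[/eqP ck /eqP ek]] /count_eq1[i0 Si0]|_ /count_eq0 S0].
    exists k; have e1 : [set i0] i by rewrite -Si0.
    have e2 : [set i0] (j k) by rewrite -Si0 -ck -ek; exact: jP.
    by rewrite e1 e2.
  by have : (set0 : set nat) i by rewrite -S0.
have jb k : (theta (j k) w).2 < (c ord_max).+1%:R * delta.
  have [_ /cellP/andP[_ h1]] := jP k; apply: lt_le_trans h1 _.
  by rewrite ler_pM2r // ler_nat cM.
(* Were [j k] larger than [k], point [k] would come before point [j k], hence be some [j k'] with
   [k'] smaller than [k] by monotonicity, and induction would give [j k' = k']. *)
have jk : forall n (k : 'I_L.+1), (k <= n)%N -> j k = k.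
  elim=> [|n IH] k.
    rewrite leqn0 => /eqP k0.
    have k_min (k' : 'I_L.+1) : (k <= k')%N by rewrite k0.
    have [k' k'E] : exists k', 0%N = j k'.
      apply: jsurj; apply: le_lt_trans (jb k).
      by rewrite leNgt (ordered_ltE _ _ ow).
    by have := jle _ _ (k_min k'); rewrite -k'E leqn0 k0 => /eqP.
  rewrite leq_eqVlt => /orP[/eqP kn|/IH //].
  have nL : (n < L.+1)%N by rewrite -ltnS -kn ltnW // ltnS ltn_ord.
  have kj : (k <= j k)%N.
    rewrite kn; have := IH (Ordinal nL) (leqnn n) => /= {1}<-.
    by apply: jlt; rewrite kn.
  have [k' k'E] : exists k', (k : nat) = j k'.
    apply: jsurj; apply: le_lt_trans (jb k).
    by rewrite leNgt (ordered_ltE _ _ ow) -leqNgt.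
  have [kk'|k'k] := leqP k k'; first by apply/eqP; rewrite eqn_leq kj k'E jle.
  have k'n : (k' <= n)%N by rewrite -ltnS -kn.
  by move: k'k; rewrite -(IH k' k'n) -k'E ltnn.
split => [k|].
  by have [/eqP te tc] := jP k; rewrite -(jk k k) //.
rewrite leNgt; apply/negP => /jsurj[k]; rewrite (jk k k) // => LE.
by have := ltn_ord k; rewrite -LE ltnn.
Qed.

End Event.
End Grid.

Section UniformMarks.
Context {R : realType} {d : measure_display} {T : measurableType d}.
Context (P : probability T R) {V : finType} {G : sgraph V}.
Context (theta : nat -> T -> dedge G * R) (theta_poisson : poisson_process P theta).

Lemma count_eventE (delta : R) (delta_gt0 : 0 < delta) L
    (e : 'I_L.+1 -> dedge G) (c : 'I_L.+1 -> nat) :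
  P (count_event theta delta e c) =
  (\prod_(x <- iota 0 (c ord_max).+1) \prod_(e' <- enum {: dedge G})
     poisson_prob delta 0%N [set mark_count e c e' x])%E.
Proof.
(* Independence is stated for sequences of sets, so the boxes are numbered by [pickle]. With
   [pickle_inv] each box has one number, and numbers of no box get the empty set. *)
pose A (i : nat) : set (dedge G * R) :=
  if @pickle_inv (nat * dedge G)%type i is Some (x, e') then box delta e' x else set0.
have mA i : marked_measurable (A i).
  rewrite /A; case: (pickle_inv _) => [[x e']|]; first exact: box_measurable.
  by move=> e'; rewrite (_ : xsection _ _ = set0) // xsection0.
have tA : trivIset setT A.
  move=> i i' _ _ [z []]; rewrite /A.
  case Ei : (pickle_inv _) => [[x e']|//]; case Ei' : (pickle_inv _) => [[x' e'']|//].
  move=> b b'; have [? ?] := box_inj delta_gt0 b b'; subst.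
  have := @pickle_invK (nat * dedge G)%type i; rewrite Ei /= => <-.
  by have := @pickle_invK (nat * dedge G)%type i'; rewrite Ei' /= => <-.
pose J := [seq pickle ((x, e') : nat * dedge G) | x <- iota 0 (c ord_max).+1,
  e' <- enum {: dedge G}].
pose E (i : nat) : set T := if @pickle_inv (nat * dedge G)%type i is Some (x, e')
  then [set w | point_count theta (box delta e' x) w = (mark_count e c e' x)%:R%:E]
  else setT.
have uJ : uniq J.
  apply: allpairs_uniq; rewrite ?iota_uniq ?enum_uniq //.
  by move=> [x y] [x' y'] _ _ /= /(pcan_inj pickleK).
have hE : forall i, i \in J ->
    sigma_of measurable setT (fun _ : unit => point_count theta (A i)) (E i).
  move=> i /allpairsP[[x e'] [_ _ ->]].
  rewrite /A /E pickleK_inv; apply: sub_sigma_algebra; exists tt => //=.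
  exists [set (mark_count e c e' x)%:R%:E]; first exact: emeasurable_set1.
  by rewrite setTI.
have := poisson_independent theta_poisson mA tA uJ hE.
rewrite -bigcap_seq [in X in _ = X -> _]/J big_allpairs_dep.
under [in X in _ = X -> _]eq_bigr => x _ do under eq_bigr => e' _ do
  rewrite /E pickleK_inv (pr_count_box theta_poisson delta_gt0).
move=> <-; congr (P _); apply/seteqP; split => w.
  move=> h i /= iJ; have := iJ => /allpairsP[[x e'] [xI _ ->]].
  by rewrite /E pickleK_inv; apply: h; move: xI; rewrite mem_iota.
move=> h x xc e'.
have := h (pickle (x, e')); rewrite /E pickleK_inv; apply.
by apply: allpairs_f; rewrite ?mem_iota ?mem_enum.
Qed.

(** All boxes have the same intensity [delta], so within a cell the product does not depend on which
    edge carries the point; exchanging [e k] and [f k] matches the factors. *)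
Lemma count_event_uniform (delta : R) (delta_gt0 : 0 < delta) L
    (e f : 'I_L.+1 -> dedge G) (c : 'I_L.+1 -> nat) : injective c ->
  P (count_event theta delta e c) = P (count_event theta delta f c).
Proof.
move=> ic; rewrite !count_eventE //; apply: eq_bigr => x _.
rewrite !big_enum /=.
have [[k ck]|nk] := pselect (exists k, c k = x); last first.
  have m0 g e' : mark_count g c e' x = 0%N.
    rewrite /mark_count; case: existsP => // -[k /andP[/eqP ck _]].
    by case: nk; exists k.
  by apply: eq_bigr => e' _; rewrite !m0.
have m1 g e' : mark_count g c e' x = (g k == e').
  rewrite /mark_count; congr nat_of_bool; apply/existsP/eqP => [[k' /andP[/eqP ck' /eqP <-]]|<-].
    by congr g; apply: ic; rewrite ck.
  by exists k; rewrite ck !eqxx.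
rewrite (reindex_inj (@perm.perm_inj _ (perm.tperm (e k) (f k)))) /=.
apply: eq_bigr => e' _; rewrite !m1; congr (poisson_prob _ _ [set nat_of_bool _]).
by rewrite -(inj_eq (@perm.perm_inj _ (perm.tperm (e k) (f k)))) perm.tpermL perm.tpermK.
Qed.

End UniformMarks.

Lemma finite_pos_lb {R : realDomainType} {I : finType} (g : I -> R) :
  (forall i, 0 < g i) -> exists2 x : R, 0 < x & forall i, x <= g i.
Proof.
move=> g0; exists (\big[Order.min/1]_i g i); last by move=> i; exact: bigmin_le_cond.
by rewrite lt_bigmin.
Qed.

Section MarksIndependentOfTimes.
Context {R : realType} {d : measure_display} {T : measurableType d}.
Context (P : probability T R) {V : finType} {G : sgraph V}.
Context (theta : nat -> T -> dedge G * R) (theta_poisson : poisson_process P theta).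

Lemma measurable_point_count A : marked_measurable A ->
  measurable_fun setT (point_count theta A).
Proof.
move=> mA; rewrite [X in measurable_fun _ X](_ : _ = fun w =>
    (\sum_(0 <= k <oo | k \in xpredT) ((\1_(theta k @^-1` A) w)%:E : \bar R))%E).
  apply: ge0_emeasurable_sum => // k _; apply/measurable_EFinP.
  by apply: measurable_indic; exact: (poisson_measurable theta_poisson).
apply/funext => w; rewrite /point_count.
pose F k : set nat := [set k' | k' = k /\ A (theta k w)].
rewrite [X in counting X](_ : _ = \bigcup_k F k); last first.
  apply/seteqP; split => [k Ak|k [k' _ [-> Ak]]] //; by exists k.
have tF : trivIset setT F by move=> i j _ _ [k [[<- _] [<- _]]].
rewrite (@measure_semi_bigcup _ R nat counting) //.
apply: eq_eseriesr => k _; rewrite indicE.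
have [|] := boolP (w \in _); rewrite ?inE ?notin_setE /= => Ak.
  rewrite (_ : F k = [set k]) ?count_set1 //.
  by apply/seteqP; split => [k' []//|k' ->].
rewrite (_ : F k = set0) ?count_set0 //.
by apply/seteqP; split => [k' []//|k' //].
Qed.

Lemma measurable_count A n : marked_measurable A ->
  mpred (fun w => point_count theta A w = n%:R%:E).
Proof.
move=> mA; have := measurable_point_count mA measurableT (emeasurable_set1 n%:R%:E).
by rewrite setTI.
Qed.

Lemma mpred_time_ge k (y : R) : mpred (fun w => y <= (theta k w).2).
Proof. exact: mpred_le (measurable_cst y) (measurable_time theta_poisson k). Qed.

Lemma mpred_time_lt k (y : R) : mpred (fun w => (theta k w).2 < y).
Proof. exact: mpred_lt (measurable_time theta_poisson k) (measurable_cst y). Qed.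

Lemma measurable_grid_event delta L (e : 'I_L.+1 -> dedge G) c :
  measurable (grid_event theta delta e c).
Proof.
apply: mpred_and; last exact: mpred_time_ge.
apply: mpred_forall_fin => k.
apply: eq_mpred (measurable_point theta_poisson k (pred1 (e k))
   (measurable_itv `[(c k)%:R * delta, (c k).+1%:R * delta[)) => w.
by split => [[/eqP]|[/eqP]].
Qed.

Lemma measurable_count_event delta L (e : 'I_L.+1 -> dedge G) c :
  measurable (count_event theta delta e c).
Proof.
apply: mpred_foralln => x; apply: mpred_imp; apply: mpred_forall_fin => e'.
by apply: measurable_count; exact: box_measurable.
Qed.

Lemma pr_grid_event_uniform (delta : R) (delta_gt0 : 0 < delta) L
    (e f : 'I_L.+1 -> dedge G) (c : 'I_L.+1 -> nat) :
  {homo c : i j / (i < j)%N >-> (i < j)%N} ->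
  pr P (grid_event theta delta e c) = pr P (grid_event theta delta f c).
Proof.
move=> c_lt.
have H g : pr P (grid_event theta delta g c) = pr P (count_event theta delta g c).
  apply: (pr_ae_eq (poisson_ordered theta_poisson)).
  - exact: measurable_grid_event.
  - exact: measurable_count_event.
  - by move=> w ow; split; [exact: grid_count | exact: count_grid].
rewrite !H /pr (count_event_uniform theta_poisson delta_gt0 e f) //.
exact: c_inj.
Qed.

Definition below_event L (e : 'I_L.+1 -> dedge G) (a : 'I_L.+1 -> R) : set T :=
  [set w | forall k : 'I_L.+1, (theta k w).1 = e k /\ (theta k w).2 < a k].

Lemma measurable_below_event L (e : 'I_L.+1 -> dedge G) a :
  measurable (below_event e a).
Proof.
apply: mpred_forall_fin => k; apply: mpred_and; last exact: mpred_time_lt.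
exact: (mfin_edge theta_poisson).
Qed.

(* Almost surely the first points lie in distinct cells of a fine enough grid, and
   the probability of given cells and marks does not depend on the marks. *)
Lemma below_event_uniform L (e f : 'I_L.+1 -> dedge G) a :
  pr P (below_event e a) = pr P (below_event f a).
Proof.
wlog suff H : e f / pr P (below_event e a) <= pr P (below_event f a).
  by apply/eqP; rewrite eq_le !H.
pose delta N : R := N.+1%:R^-1.
have delta_gt0 N : 0 < delta N by rewrite invr_gt0.
(* A cell that ends after [S] ends after every [a k], so finitely many cells are enough. *)
pose S : R := \sum_k `|a k|.
have aS k : a k <= S.
  by apply: le_trans (ler_norm _) _; rewrite /S (bigD1 k) //= lerDl sumr_ge0.
have S0 : 0 <= S by apply: sumr_ge0.
pose M N := (Num.trunc (S / delta N)).+1.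
have MP N x : x.+1%:R * delta N <= S -> (x < M N)%N.
  move=> xS; have /truncn_itv/andP[_] : 0 <= S / delta N by rewrite divr_ge0 // ltW.
  rewrite ltr_pdivrMr // => h; have := le_lt_trans xS h.
  by rewrite ltr_pM2r // ltr_nat => /ltnW.
pose good N (c : {ffun 'I_L.+1 -> 'I_(M N)}) : bool :=
  [forall i : 'I_L.+1, forall j : 'I_L.+1, (i < j)%N ==> (c i < c j)%N] &&
  [forall k : 'I_L.+1, (c k).+1%:R * delta N <= a k].
pose A (g : 'I_L.+1 -> dedge G) N (c : {ffun 'I_L.+1 -> 'I_(M N)}) : set T :=
  if good N c then grid_event theta (delta N) g (fun k => c k) else set0.
pose U g N := \bigcup_c A g N c.
have mA g N c : measurable (A g N c).
  by rewrite /A; case: ifP => _ //; exact: measurable_grid_event.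
have mU g N : measurable (U g N).
  by apply: fin_bigcup_measurable => [|c _]; [exact: finite_finset|].
have Ueq N : pr P (U e N) = pr P (U f N).
  have tA g : trivIset setT (A g N).
    move=> c c' _ _ [w []]; rewrite /A; case: ifP => // _ [h _]; case: ifP => // _ [h' _].
    apply/ffunP => k; apply/val_inj.
    exact: (cell_inj (delta_gt0 N) (h k).2 (h' k).2).
  rewrite !pr_bigcup_fin //; apply: eq_bigr => c _; rewrite /A; case: ifP => // /andP[g _].
  by apply: pr_grid_event_uniform => // i j ij; move/forallP/(_ i)/forallP/(_ j)/implyP: g; apply.
have UB g N w : U g N w -> below_event g a w.
  case=> c _; rewrite /A; case: ifP => // /andP[_ /forallP ca] [h _] k.
  have [te /cellP/andP[_ tc]] := h k; split => //.
  exact: lt_le_trans tc (ca k).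
have mB g : measurable (below_event g a) by exact: measurable_below_event.
pose B : set T := [set w | exists M, forall n, (M <= n)%N -> U e n w].
have mB' : measurable B.
  by apply: mpred_existsn => M'; apply: mpred_foralln => n; apply: mpred_imp; exact: mU.
apply: (@le_trans _ _ (pr P B)); last first.
  apply: (pr_liminf mB' (mU e)) => //; exists 0%N => n _.
  by rewrite Ueq; apply: pr_le => // w; exact: UB.
apply: (pr_ae (poisson_ordered theta_poisson)) => // w ow ew.
(* A margin for this sample point: cells no longer than [gamma] separate the points and stay below
   the bounds. *)
have [gamma [g0 gP]] : exists gamma : R, 0 < gamma /\ forall k : 'I_L.+1,
    (theta k w).2 + gamma <= a k /\ (theta k w).2 + gamma <= (theta k.+1 w).2.
  have p1 (k : 'I_L.+1) : 0 < Num.min (a k - (theta k w).2) ((theta k.+1 w).2 - (theta k w).2).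
    by rewrite lt_min !subr_gt0 (ew k).2 (ow.2 k).
  have [gamma g0 gP] := finite_pos_lb p1.
  exists gamma; split => // k; have := gP k.
  by rewrite le_min !lerBrDl => /andP[].
exists (Num.trunc gamma^-1) => N hN.
have dg : delta N <= gamma.
  rewrite -[leRHS]invrK lef_pV2 ?posrE ?invr_gt0 //.
  have /truncn_itv/andP[_ /ltW] : 0 <= gamma^-1 by rewrite invr_ge0 ltW.
  by move/le_trans; apply; rewrite ler_nat.
have cex (k : 'I_L.+1) : exists x : 'I_(M N), cell (delta N) x (theta k w).2 /\
    x.+1%:R * delta N <= (theta k w).2 + gamma.
  have [x cx] := cell_exists (delta_gt0 N) (ltW (ordered_gt0 k ow)).
  have xg : x.+1%:R * delta N <= (theta k w).2 + gamma.
    have /cellP/andP[h _] := cx.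
    by rewrite -natr1 mulrDl mul1r lerD.
  have xM : (x < M N)%N.
    by apply: MP; apply: le_trans xg (le_trans (gP k).1 (aS k)).
  by exists (Ordinal xM).
have [c cP] := fin_all_exists cex.
exists [ffun k => c k] => //; rewrite /A ifT; last first.
  apply/andP; split.
    apply/forallP => i; apply/forallP => j; apply/implyP => ij; rewrite !ffunE.
    apply: (cell_ge (delta_gt0 N) (cP j).1).
    apply: le_trans (cP i).2 _; apply: le_trans (gP i).2 _.
    by rewrite leNgt (ordered_ltE _ _ ow) -leqNgt.
  apply/forallP => k; rewrite ffunE; exact: le_trans (cP k).2 (gP k).1.
split => [k|]; first by rewrite ffunE; split; [exact: (ew k).1 | exact: (cP k).1].
by rewrite ffunE; apply: le_trans (cP ord_max).2 (gP ord_max).2.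
Qed.

End MarksIndependentOfTimes.

Lemma expR_partial_sum {R : realType} (x : R) n : 0 <= x ->
  \sum_(r < n) x ^+ r / r`!%:R <= expR x.
Proof.
move=> x0.
have nd : nondecreasing_seq (series (exp_coeff x)).
  by apply: nondecreasing_series => k *; exact: exp_coeff_ge0.
have := nondecreasing_cvgn_le nd (is_cvg_series_exp_coeff x) n.
by rewrite /series /= big_mkord.
Qed.

(** Chernoff's bound. After multiplication by [expR mu] it is a termwise comparison of exponential
    series: mu^r is at most t^(-j) (mu t)^r for r >= j, as t >= 1. *)
Lemma poisson_tail {R : realType} (mu t : R) j : 0 < mu -> 1 <= t ->
  1 - \sum_(r < j) poisson_pmf mu r <= t ^- j * expR (mu * (t - 1)).
Proof.
move=> mu0 t1; have t0 : 0 < t by exact: lt_le_trans t1.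
have -> : \sum_(r < j) poisson_pmf mu r =
    (\sum_(r < j) mu ^+ r / r`!%:R) * expR (- mu).
  by rewrite mulr_suml; apply: eq_bigr => r _; rewrite /poisson_pmf mu0.
have main : expR mu <= \sum_(r < j) mu ^+ r / r`!%:R + t ^- j * expR (mu * t).
  apply: limr_le; first exact: is_cvg_series_exp_coeff.
  near=> n; rewrite /series /= big_mkord.
  have jn : (j <= n)%N by near: n; exact: nbhs_infty_ge.
  have mt0 : 0 <= mu * t by rewrite mulr_ge0 // ltW.
  apply: (@le_trans _ _ (\sum_(r < j) mu ^+ r / r`!%:R +
      t ^- j * \sum_(r < n) (mu * t) ^+ r / r`!%:R)); last first.
    by rewrite lerD2l ler_wpM2l ?invr_ge0 ?exprn_ge0 ?(ltW t0) // expR_partial_sum.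
  rewrite (big_ord_widen n (fun r => mu ^+ r / r`!%:R) jn) [X in _ <= X + _]big_mkcond /=.
  rewrite mulr_sumr -big_split /=; apply: ler_sum => r _.
  have f0 : 0 <= r`!%:R^-1 :> R by rewrite invr_ge0.
  have m0 : 0 <= mu ^+ r by rewrite exprn_ge0 // ltW.
  rewrite /exp_coeff /=; case: ifPn => [_|].
    by rewrite lerDl !mulr_ge0 ?invr_ge0 ?exprn_ge0 // ltW.
  rewrite -leqNgt add0r mulrA => jr; apply: ler_wpM2r => //.
  rewrite exprMn mulrCA -[leLHS]mulr1 ler_wpM2l //.
  rewrite ler_pdivlMl ?exprn_gt0 // mulr1.
  exact: ler_weXn2l.
have e0 : 0 < expR (- mu) :> R by exact: expR_gt0.
rewrite -(ler_pM2r (expR_gt0 mu)) mulrBl mul1r -mulrA -expRD addNr expR0 mulr1.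
rewrite -mulrA -expRD (_ : mu * (t - 1) + mu = mu * t); last by ring.
by rewrite lerBlDl.
Unshelve. all: by end_near.
Qed.

(** * Gaps between the points *)

Section Interarrival.
Context {R : realType} {d : measure_display} {T : measurableType d}.
Context (P : probability T R) {V : finType} {G : sgraph V}.
Context (theta : nat -> T -> dedge G * R) (theta_poisson : poisson_process P theta).
Local Notation m := (#|{: dedge G}|%:R : R).
Hypothesis m_gt0 : 0 < m.

Definition count_ge (A : set (dedge G * R)) (j : nat) : set T :=
  [set w | (j%:R%:E <= point_count theta A w)%E].

Lemma count_geE A j w : ~ count_ge A j w <->
  exists r : 'I_j, point_count theta A w = (r : nat)%:R%:E.
Proof.
rewrite /count_ge /= /point_count /counting; case: asboolP => fA; last first.
  by rewrite leey; split => [/(_ isT) []|[r /eqP]].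
split => [/negP|[r [->]]].
  by rewrite lee_fin -ltNge ltr_nat => rj; exists (Ordinal rj).
by apply/negP; rewrite lee_fin -ltNge ltr_nat.
Qed.

Lemma mpred_count_lt A j : marked_measurable A -> mpred (fun w => ~ count_ge A j w).
Proof.
move=> mA; apply: (@eq_mpred _ _ (fun w =>
  exists r : 'I_j, point_count theta A w = (r : nat)%:R%:E)).
  by move=> w; split => /count_geE.
by apply: mpred_exists_fin => r; exact: (measurable_count theta_poisson).
Qed.

Lemma measurable_count_ge A j : marked_measurable A -> measurable (count_ge A j).
Proof.
move=> mA; apply: (@eq_mpred _ _ (fun w => ~ ~ count_ge A j w)).
  by move=> w; split => [/contrapT|h /(_ h)].
by apply: mpred_not; exact: mpred_count_lt.
Qed.

Lemma pr_count_ge (I : set R) (l : R) j : measurable I -> I `<=` `[0, +oo[ ->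
  lebesgue_measure I = l%:E -> 0 < l ->
  pr P (count_ge (slab predT I) j) = 1 - \sum_(r < j) poisson_pmf (m * l) r.
Proof.
move=> mI I0 Il l0; set A := slab predT I.
have mA : marked_measurable A by exact: slab_measurable.
have IA : intensity A = (m * l)%:E.
  by rewrite (slab_intensity _ I0 Il) cardE -cardT.
pose F (r : 'I_j) := [set w | point_count theta A w = (r : nat)%:R%:E].
have mF r : measurable (F r) by exact: (measurable_count theta_poisson).
have tF : trivIset setT F.
  by move=> r r' _ _ [w []]; rewrite /F /= => -> [] /eqP; rewrite eqr_nat => /eqP/val_inj.
have -> : count_ge A j = setT `\` \bigcup_r F r.
  apply/seteqP; split => w.
    move=> h; split => // -[r _ Fr].
    by have /count_geE : exists r : 'I_j, point_count theta A w = (r : nat)%:R%:E by exists r.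
  by move=> [_ h]; apply: contrapT => /count_geE [r Fr]; apply: h; exists r.
rewrite pr_setD //; last first.
  by apply: fin_bigcup_measurable => [|r _]; [exact: finite_finset|].
rewrite pr_setT pr_bigcup_fin //; congr (_ - _); apply: eq_bigr => r _.
rewrite /pr (poisson_law theta_poisson) ?IA ?ltry // /poisson_prob.
rewrite mulr_gt0 // esum_set1 // lee_fin; exact: poisson_pmf_ge0.
Qed.

Lemma count_ge_independent A1 A2 j1 j2 :
  marked_measurable A1 -> marked_measurable A2 -> A1 `&` A2 = set0 ->
  pr P (count_ge A1 j1 `&` count_ge A2 j2) =
  pr P (count_ge A1 j1) * pr P (count_ge A2 j2).
Proof.
move=> mA1 mA2 A12.
pose A (i : nat) := if i is 0%N then A1 else if i is 1%N then A2 else set0.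
pose E (i : nat) := if i is 0%N then count_ge A1 j1 else count_ge A2 j2.
have mA i : marked_measurable (A i).
  by case: i => [|[|i]] //= e; rewrite xsection0.
have tA : trivIset setT A.
  by move=> [|[|i]] [|[|j]] _ _ //= [z [h1 h2]] //;
    have : (A1 `&` A2) z by []; rewrite A12.
have := poisson_independent theta_poisson mA tA => /(_ [:: 0%N; 1%N] E erefl).
rewrite !big_cons !big_nil setIT mule1 => /(_ _)/(congr1 fine).
rewrite fineM ?fin_num_measure //; try exact: measurable_count_ge.
apply=> i; rewrite !inE => /orP[] /eqP -> /=; apply: sub_sigma_algebra; exists tt => //.
  exists `[j1%:R%:E, +oo[%classic; first exact: emeasurable_itv.
  by rewrite setTI; apply/seteqP; split => w; rewrite /count_ge /= in_itv /= andbT.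
exists `[j2%:R%:E, +oo[%classic; first exact: emeasurable_itv.
by rewrite setTI; apply/seteqP; split => w; rewrite /count_ge /= in_itv /= andbT.
Qed.

Lemma time_lt_count w (b : R) i : ordered_at theta w ->
  (theta i w).2 < b <-> count_ge (slab predT `[0, b[) i.+1 w.
Proof.
move=> ow; split => h.
  apply: (count_iota (a := 0)) => k; rewrite add0n /= ltnS => ki.
  split => //; rewrite /= in_itv /= (ltW (ordered_gt0 k ow)) /=.
  by apply: le_lt_trans h; rewrite leNgt (ordered_ltE _ _ ow) -leqNgt.
rewrite ltNge; apply/negP => bi; move: h; rewrite /count_ge /=; apply/negP.
rewrite -ltNge; apply: (@le_lt_trans _ _ i%:R%:E); last by rewrite lte_fin ltr_nat.
apply: count_le_iota => k [_ /=]; rewrite in_itv /= => /andP[_ kb].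
by rewrite -(ordered_ltE _ _ ow) (lt_le_trans kb).
Qed.

(* If [t(i)] is in the cell [c*delta, (c+1)*delta) and [t(i+1)] is not, which
   holds for small [delta], a gap of at most [x] forces [j] points in
   [(c+1)*delta, (c+1)*delta + x), a set independent of the past. *)
Lemma pr_gap_le i j (x : R) : (0 < j)%N -> 0 < x ->
  pr P [set w | (theta (i + j) w).2 - (theta i w).2 <= x] <=
  1 - \sum_(r < j) poisson_pmf (m * x) r.
Proof.
move=> j0 x0; set tail := 1 - _.
pose delta N : R := N.+1%:R^-1.
have delta_gt0 N : 0 < delta N by rewrite invr_gt0.
pose C N (c : nat) : set T := [set w | cell (delta N) c (theta i w).2].
pose I N (c : nat) : set R := `[c.+1%:R * delta N, c.+1%:R * delta N + x[%classic.
pose D N (c : nat) : set T := count_ge (slab predT (I N c)) j.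
have mI N c : measurable (I N c) by exact: measurable_itv.
have mD N c : measurable (D N c) by apply: measurable_count_ge; exact: slab_measurable.
have mC N c : measurable (C N c).
  have := measurable_time theta_poisson i measurableT
    (measurable_itv `[c%:R * delta N, c.+1%:R * delta N[).
  by rewrite setTI.
have prD N c : pr P (D N c) = tail.
  rewrite /D (pr_count_ge (l := x)) //.
    move=> t; rewrite /I /= !in_itv /= => /andP[h _]; rewrite andbT (le_trans _ h) //.
    by rewrite mulr_ge0 // ltW.
  by rewrite lebesgue_measure_itv /= lte_fin ltrDl x0 -EFinB addrAC subrr add0r.
have tail0 : 0 <= tail by rewrite -(prD 0%N 0%N) pr_ge0.
(* Almost surely [X b] is the event that point [i] comes before [b], written with counts to the left
   of [b]. *)
pose X (b : R) := count_ge (slab predT `[0, b[) i.+1.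
have mX b : measurable (X b).
  by apply: measurable_count_ge; apply: slab_measurable; exact: measurable_itv.
have indX N c b : b <= c.+1%:R * delta N ->
    pr P (X b `&` D N c) = pr P (X b) * pr P (D N c).
  move=> bc; apply: count_ge_independent; try exact: slab_measurable.
  apply/seteqP; split => // -[e t] [[_ /= h1] [_ /= h2]].
  move: h1 h2; rewrite /I /= !in_itv /= => /andP[_ tb] /andP[bt _].
  by have := lt_le_trans tb (le_trans bc bt); rewrite ltxx.
have cc N c : c%:R * delta N <= c.+1%:R * delta N by rewrite ler_pM2r // ler_nat.
have XX N c : X (c%:R * delta N) `<=` X (c.+1%:R * delta N).
  move=> w; rewrite /X /count_ge /= => /le_trans; apply.
  apply: le_measure; rewrite ?inE // => k [_ /= h]; split => //.
  move: h; rewrite /= !in_itv /= => /andP[-> /lt_le_trans]; apply; exact: cc.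
have CX N c w : ordered_at theta w -> C N c w <->
    (X (c.+1%:R * delta N) `\` X (c%:R * delta N)) w.
  move=> ow; rewrite /C /= cellP; split => [/andP[h1 h2]|[/(time_lt_count _ _ ow) h1 h2]].
    split; first exact/time_lt_count.
    by move/(time_lt_count _ _ ow); rewrite ltNge h1.
  rewrite h1 andbT leNgt; apply/negP => /(time_lt_count _ _ ow); exact: h2.
(* [C N c] is almost surely the difference of the events [X] at the two ends of the cell, each
   independent of the window that starts at the right end. *)
have prCD N c : pr P (C N c `&` D N c) = pr P (C N c) * tail.
  rewrite -(prD N c).
  have -> : pr P (C N c) = pr P (X (c.+1%:R * delta N)) - pr P (X (c%:R * delta N)).
    rewrite -pr_setD //; apply: (pr_ae_eq (poisson_ordered theta_poisson)).
    - exact: mC.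
    - exact: measurableD.
    - by move=> w; exact: CX.
  rewrite mulrBl -!indX // -pr_setD; [|exact: measurableI|exact: measurableI|].
    apply: (pr_ae_eq (poisson_ordered theta_poisson)); first exact: measurableI.
      by apply: measurableD; exact: measurableI.
    move=> w ow; split => [[/(CX _ _ _ ow)[h1 h2] h3]|[[h1 h3] h2]].
      by split => // -[].
    by split => //; apply/(CX _ _ _ ow); split => // h; apply: h2.
  by apply: setSI; exact: XX.
(* These cells, of length 1 / (N + 1), cover the times below [N]. *)
pose A N : set T := \bigcup_(c : 'I_(N * N.+1)) (C N c `&` D N c).
have mA N : measurable (A N).
  by apply: fin_bigcup_measurable => [|c _]; [exact: finite_finset|exact: measurableI].
have tC N : trivIset setT (fun c : 'I_(N * N.+1) => C N c).
  move=> c c' _ _ [w [h h']]; apply/val_inj; exact: (cell_inj (delta_gt0 N) h h').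
have prA N : pr P (A N) <= tail.
  rewrite pr_bigcup_fin => [|c|c c' _ _ [w [[h _] [h' _]]]]; last 2 first.
  - exact: measurableI.
  - by apply/val_inj; exact: (cell_inj (delta_gt0 N) h h').
  under eq_bigr do rewrite prCD.
  have sC := pr_bigcup_fin P (fun c : 'I_(N * N.+1) => mC N c) (tC N).
  rewrite -mulr_suml -[leRHS]mul1r; apply: ler_wpM2r => //.
  rewrite -sC; apply: pr_le1.
  by apply: fin_bigcup_measurable => [|c _]; [exact: finite_finset|exact: mC].
pose B : set T := [set w | exists M, forall n, (M <= n)%N -> A n w].
have mB : measurable B.
  by apply: mpred_existsn => M'; apply: mpred_foralln => n; apply: mpred_imp; exact: mA.
apply: (@le_trans _ _ (pr P B)); last first.
  by apply: (pr_liminf mB mA) => //; exists 0%N => n _.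
have mG : measurable [set w | (theta (i + j) w).2 - (theta i w).2 <= x].
  apply: mpred_le => //.
  by apply: measurable_funB; exact: (measurable_time theta_poisson).
apply: (pr_ae (poisson_ordered theta_poisson)) => // w ow /= gx.
set gamma := (theta i.+1 w).2 - (theta i w).2.
have g0 : 0 < gamma by rewrite subr_gt0 (ow.2 i).
exists (maxn (Num.trunc gamma^-1) (Num.trunc (theta i w).2).+1) => N.
rewrite geq_max => /andP[hN tN].
have dg : delta N <= gamma.
  rewrite -[leRHS]invrK lef_pV2 ?posrE ?invr_gt0 //.
  have /truncn_itv/andP[_ /ltW] : 0 <= gamma^-1 by rewrite invr_ge0 ltW.
  by move/le_trans; apply; rewrite ler_nat.
have ti0 := ltW (ordered_gt0 i ow).
have tiN : (theta i w).2 < N%:R.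
  have /truncn_itv/andP[_ h] := ti0.
  by apply: lt_le_trans h _; rewrite ler_nat.
have [c cc'] := cell_exists (delta_gt0 N) ti0.
have cN : (c < N * N.+1)%N.
  apply: (cell_le (delta_gt0 N) cc').
  by rewrite natrM /delta mulfK.
exists (Ordinal cN) => //; split => //=.
have /cellP/andP[c1 c2] := cc'.
apply: (count_iota (a := i.+1)) => k /andP[ik ki]; split => //=.
rewrite /I /= in_itv /=; apply/andP; split.
  have : (theta i.+1 w).2 <= (theta k w).2.
    by rewrite leNgt (ordered_ltE _ _ ow) -leqNgt.
  apply: le_trans; rewrite -natr1 mulrDl mul1r.
  by have := lerD c1 dg; rewrite /gamma subrKC.
have : (theta k w).2 <= (theta (i + j) w).2.
  by rewrite leNgt (ordered_ltE _ _ ow) -leqNgt -ltnS -addSn.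
move: gx c2; lra.
Qed.

End Interarrival.

(** * Inversions caused by the noise *)

Section GaussianTail.
Context {R : realType}.

(* On [A] the centred density is at most [expR (9 / 2 - 3 * a)] times the density
   centred at [kappa * sigma]. *)
Lemma normal_prob_shift (sigma kappa a : R) (A : set R) : 0 < sigma ->
  kappa ^+ 2 = 9 -> measurable A -> (forall x, A x -> 3 * a * sigma <= kappa * x) ->
  (normal_prob 0 sigma A <= (expR (9 / 2 - 3 * a))%:E)%E.
Proof.
move=> s0 k9 mA Ax; set c := expR _.
have sn0 : sigma != 0 by rewrite gt_eqF.
have pdf_le x : A x ->
    normal_pdf 0 sigma x <= c * normal_pdf (kappa * sigma) sigma x.
  move=> /Ax h; rewrite !normal_pdfE // /normal_fun mulrCA ler_wpM2l ?normal_peak_ge0 //.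
  rewrite /c -expRD ler_expR subr0.
  have s2 : 0 < sigma ^+ 2 *+ 2 by rewrite mulrn_wgt0 // exprn_gt0.
  have -> : 9 / 2 - 3 * a + - (x - kappa * sigma) ^+ 2 / (sigma ^+ 2 *+ 2) =
     - x ^+ 2 / (sigma ^+ 2 *+ 2) + (kappa * x - 3 * a * sigma) / sigma.
    rewrite -k9; field; exact: sn0.
  by rewrite lerDl divr_ge0 ?subr_ge0 // ltW.
have c0 : 0 <= c by exact: expR_ge0.
have mpdf m : measurable_fun A (fun x => (normal_pdf m sigma x)%:E).
  by apply/measurable_EFinP; apply: measurable_funTS; exact: measurable_normal_pdf.
apply: (@le_trans _ _ (c%:E * normal_prob (kappa * sigma) sigma A)%E); last first.
  rewrite -[leRHS]mule1; apply: lee_pmul => //.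
  exact: (probability_le1 (normal_prob (kappa * sigma) sigma)).
have pdf0 mu x : A x -> (0 <= (normal_pdf mu sigma x)%:E)%E.
  by move=> _; rewrite lee_fin normal_pdf_ge0.
have /= cE := ge0_integralZl_EFin lebesgue_measure mA (pdf0 (kappa * sigma))
  (mpdf (kappa * sigma)) c0.
rewrite /normal_prob -cE.
apply: ge0_le_integral.
- exact: mA.
- exact: pdf0.
- exact: mpdf.
- exact: (measurable_funeM _ (mpdf _)).
- by move=> x Ax'; rewrite -EFinM lee_fin pdf_le.
Qed.

Context {d : measure_display} {T : measurableType d} (P : probability T R).

(** [normal_prob_shift] with a shift of three standard deviations to either side. The decay rate 3
    in [a] exceeds the growth rate 2 in [pr_gap_rate]. *)
Lemma brownian_tail (B : R -> T -> R) (s a : R) : standard_brownian P B -> 0 < s ->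
  pr P [set w | a * Num.sqrt s <= `|B s w|] <= 2 * expR (9 / 2 - 3 * a).
Proof.
move=> Bb s0; set sigma := Num.sqrt s.
have sg0 : 0 < sigma by rewrite sqrtr_gt0.
(* The law is given for increments; [B 0] vanishes almost surely. *)
pose D w := B s w - B 0 w.
have mB t : 0 <= t -> measurable_fun setT (B t) by exact: (brownian_measurable Bb).
have mD : measurable_fun setT D by apply: measurable_funB; apply: mB => //; exact: ltW.
have law A : measurable A -> P (D @^-1` A) = normal_prob 0 sigma A.
  move=> mA; have := brownian_increment Bb (s := 0) (t := s).
  by rewrite lexx s0 subr0 => /(_ isT) /(_ A mA).
have mI1 : measurable (D @^-1` `[a * sigma, +oo[).
  by rewrite -[X in measurable X]setTI; apply: mD.
have mI2 : measurable (D @^-1` `]-oo, - (a * sigma)]).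
  by rewrite -[X in measurable X]setTI; apply: mD.
apply: (@le_trans _ _ (pr P (D @^-1` `[a * sigma, +oo[ `|` D @^-1` `]-oo, - (a * sigma)]))).
  apply: (pr_ae (brownian_start Bb)).
  - apply: mpred_le => //.
    by apply: measurableT_comp => //; apply: mB; exact: ltW.
  - exact: measurableU.
  - move=> w B0 /=; rewrite /D B0 subr0 !in_itv /= andbT ler_normr lerNr.
    by case/orP; [left | right].
apply: (le_trans (prU_le P mI1 mI2)).
have H A (kappa : R) : measurable (D @^-1` A) -> measurable A -> kappa ^+ 2 = 9 ->
    (forall x, A x -> 3 * a * sigma <= kappa * x) ->
    pr P (D @^-1` A) <= expR (9 / 2 - 3 * a).
  move=> mDA mA k9 hA; rewrite -lee_fin -prE // law //.
  exact: normal_prob_shift k9 mA hA.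
rewrite mulr_natl mulr2n; apply: lerD.
  apply: (H _ 3) => //; first by ring.
  by move=> x; rewrite /= in_itv /= andbT; lra.
apply: (H _ (-3)) => //; first by ring.
by move=> x; rewrite /= in_itv /=; lra.
Qed.

End GaussianTail.

Section Inversions.
Context {R : realType} {V : finType} {G : sgraph V} {d : measure_display}
  {T : measurableType d} (P : probability T R) (p : R)
  (xi : V -> T -> bool) (theta : nat -> T -> dedge G * R) (B : nat -> R -> T -> R).
Hypothesis model : noisy_voter_model P p xi theta B.
Local Notation m := (#|{: dedge G}|%:R : R).
Hypothesis m_gt0 : 0 < m.

Let theta_poisson := points_poisson model.

Definition noise_events : set (set T) := <<s \bigcup_k sigma_path (B k) >>.
Definition rest_events : set (set T) := <<s sigma_init xi `|` sigma_points theta >>.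

Lemma noise_event k (s : R) (I : set R) : 0 <= s -> measurable I ->
  noise_events (B k s @^-1` I).
Proof.
move=> s0 mI; apply: sub_sigma_algebra; exists k => //.
apply: sub_sigma_algebra; exists s => //; exists I => //.
by rewrite setTI.
Qed.

Lemma points_event k A : marked_measurable A -> rest_events (theta k @^-1` A).
Proof.
move=> mA; apply: sub_sigma_algebra; right.
apply: sub_sigma_algebra; exists k => //; exists A => //.
by rewrite setTI.
Qed.

Lemma gap_event i k (x : R) :
  rest_events [set w | (theta k w).2 - (theta i w).2 <= x].
Proof.
(* The sample space with the sigma-algebra of the initial opinions and the points: measurability
   there is membership in [rest_events]. *)
pose T' := g_sigma_algebraType (sigma_init xi `|` sigma_points theta).
have mt j : measurable_fun setT (fun w : T' => (theta j w).2).
  move=> _ I mI; rewrite setTI.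
  have -> : (fun w : T' => (theta j w).2) @^-1` I = theta j @^-1` slab predT I.
    by apply/seteqP; split => w; [move=> h; split | case].
  have h := points_event j (slab_measurable (G := G) predT mI); exact: h.
have mf : measurable_fun setT (fun w : T' => (theta k w).2 - (theta i w).2).
  by apply: measurable_funB.
have := mf measurableT _ (measurable_itv `]-oo, x]).
by rewrite setTI.
Qed.

Lemma measurable_noise k s : 0 <= s -> measurable_fun setT (B k s).
Proof. by move=> s0; exact: (brownian_measurable (noise_brownian model k) s0). Qed.

Section Level.
Context (s : R) (s_gt0 : 0 < s).
Local Notation sigma := (Num.sqrt s).
Local Notation eps := (m * sigma).
Let sigma_gt0 : 0 < sigma. Proof. by rewrite sqrtr_gt0. Qed.
Let eps_gt0 : 0 < eps. Proof. by rewrite mulr_gt0. Qed.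

Definition inversion_rate : R := eps / (1 + eps).

(** The Chernoff parameter is [1 + eps^-1]: its inverse is [inversion_rate], and the exponent
    becomes [2 * a.+1%:R], free of [eps]. *)
Lemma pr_gap_rate i j (a : nat) : (0 < j)%N ->
  pr P [set w | (theta (i + j) w).2 - (theta i w).2 <= 2 * a.+1%:R * sigma] <=
  inversion_rate ^+ j * expR (2 * a.+1%:R).
Proof.
move=> j0; have x0 : 0 < 2 * a.+1%:R * sigma by rewrite !mulr_gt0.
apply: (le_trans (pr_gap_le theta_poisson m_gt0 i j0 x0)).
have t1 : 1 <= 1 + eps^-1 by rewrite lerDl invr_ge0 ltW.
apply: (le_trans (poisson_tail j (mulr_gt0 m_gt0 x0) t1)).
have -> : m * (2 * a.+1%:R * sigma) * (1 + eps^-1 - 1) = 2 * a.+1%:R.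
  by field; rewrite !gt_eqF.
rewrite -exprVn (_ : (1 + eps^-1)^-1 = inversion_rate) // /inversion_rate.
have e1 : 1 + eps != 0 by rewrite gt_eqF // addr_gt0.
have e0 : eps != 0 by rewrite gt_eqF.
move: eps e1 e0 => y y1 y0; have y1' : y + 1 != 0 by rewrite addrC.
by field; rewrite ?y0 ?y1 ?y1'.
Qed.

(** For a noise between [a] and [a + 1] standard deviations, tail and gap bounds multiply to 2
    e^(9/2 - 3a) e^(2a + 2) = 2 e^(13/2) e^(-a), at most 4 e^(13/2) 2^(-a-1), up to the rate. The
    sum over [a] is 4 e^(13/2), and it occurs once for either point. *)
Definition inversion_const : R := 8 * expR (13 / 2).

(** Splitting by the integer part [a] of the noise in units of [sigma] makes the threshold for the
    gap deterministic, and noise and times are independent. *)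
Lemma pr_noise_gap i j l : (0 < j)%N ->
  pr P [set w | (theta (i + j) w).2 - (theta i w).2 <= 2 * `|B l s w|] <=
  inversion_const / 2 * inversion_rate ^+ j.
Proof.
move=> j0.
have rate0 : 0 <= inversion_rate.
  by rewrite divr_ge0 ?addr_ge0 ?(ltW eps_gt0).
pose E (a : nat) := B l s @^-1` [set x | a%:R * sigma <= `|x| < a.+1%:R * sigma].
pose F (a : nat) := [set w | (theta (i + j) w).2 - (theta i w).2 <= 2 * a.+1%:R * sigma].
have mI (a : nat) : measurable [set x : R | a%:R * sigma <= `|x| < a.+1%:R * sigma].
  have mn : measurable_fun setT (fun x : R => `|x|) by apply: measurableT_comp.
  have := mn measurableT _ (measurable_itv `[a%:R * sigma, a.+1%:R * sigma[).
  by rewrite setTI; apply: eq_mpred => w; rewrite /= in_itv.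
have mBs : measurable_fun setT (B l s) by apply: measurable_noise; exact: ltW.
have mE a : measurable (E a).
  by rewrite /E -[X in measurable X]setTI; apply: mBs.
have mt k : measurable_fun setT (fun w => (theta k w).2).
  exact: (measurable_time theta_poisson).
have mF a : measurable (F a).
  by apply: mpred_le => //; apply: measurable_funB.
have bound a : pr P (E a `&` F a) <=
    (inversion_const / 2 * inversion_rate ^+ j) / (2 ^ a.+1)%:R.
  have -> : pr P (E a `&` F a) = pr P (E a) * pr P (F a).
    rewrite /pr (noise_rest_independent model) ?fineM ?fin_num_measure //.
      by apply: noise_event; [exact: ltW | exact: mI].
    exact: gap_event.
  have h1 : pr P (E a) <= 2 * expR (9 / 2 - 3 * a%:R).
    apply: le_trans (brownian_tail a%:R (noise_brownian model l) s_gt0).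
    apply: pr_le => // [|w /andP[]//].
    by apply: mpred_le => //; apply: measurableT_comp.
  apply: (le_trans (ler_pM (pr_ge0 _ _) (pr_ge0 _ _) h1 (pr_gap_rate i a j0))).
  rewrite /inversion_const ler_pdivlMr ?ltr0n ?expn_gt0 //.
  have -> : 2 * expR (9 / 2 - 3 * a%:R) * (inversion_rate ^+ j * expR (2 * a.+1%:R)) *
      (2 ^ a.+1)%:R = 8 * expR (13 / 2) / 2 * inversion_rate ^+ j *
      (expR (- a%:R) * (2 ^ a)%:R).
    have -> : 9 / 2 - 3 * a%:R = 13 / 2 + (- a%:R - 2 * a.+1%:R) :> R.
      by rewrite -natr1; field.
    rewrite !expRD !expRN expnS natrM.
    by field; rewrite !gt_eqF ?expR_gt0.
  rewrite ler_piMr ?mulr_ge0 ?exprn_ge0 ?expR_ge0 // expRN ler_pdivrMl ?expR_gt0 // mulr1.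
  rewrite natrX -[in leRHS](mulr1 a%:R) expRM_natl.
  apply: lerXn2r; rewrite ?nnegrE ?expR_ge0 //.
  have := expR_ge1Dx (1 : R); lra.
apply: (prU_sigma_le (A := fun a => E a `&` F a)) => //.
- apply: mpred_le; first by apply: measurable_funB.
  by apply: measurable_funM => //; apply: measurableT_comp.
- by move=> a; exact: measurableI.
- move=> w /= h; exists (Num.trunc (`|B l s w| / sigma)) => //.
  have /truncn_itv : 0 <= `|B l s w| / sigma by rewrite divr_ge0 // ltW.
  rewrite ler_pdivlMr // ltr_pdivrMr // => /andP[h1 h2].
  split; first by rewrite /E /= h1 h2.
  by rewrite /F /=; move: h h2; lra.
- by rewrite !mulr_ge0 ?exprn_ge0 ?expR_ge0.
Qed.

Definition moved_time k w : R := `|(theta k w).2 + B k s w|.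

Lemma measurable_moved_time k : measurable_fun setT (moved_time k).
Proof.
apply: measurableT_comp => //; apply: measurable_funD.
  exact: (measurable_time theta_poisson).
by apply: measurable_noise; exact: ltW.
Qed.

(** In an inversion the gap is at most the sum of the two displacements, reflection included, so one
    of them is at least half of the gap. *)
Lemma pr_inversion i k : (i < k)%N ->
  pr P [set w | moved_time k w < moved_time i w] <=
  inversion_const * inversion_rate ^+ (k - i).
Proof.
move=> ik; have j0 : (0 < k - i)%N by rewrite subn_gt0.
pose H l := [set w | (theta (i + (k - i)) w).2 - (theta i w).2 <= 2 * `|B l s w|].
have mt j : measurable_fun setT (fun w => (theta j w).2).
  exact: (measurable_time theta_poisson).
have mH l : measurable (H l).
  apply: mpred_le; first by apply: measurable_funB.
  apply: measurable_funM => //.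
  by apply: measurableT_comp => //; apply: measurable_noise; exact: ltW.
apply: (@le_trans _ _ (pr P (H i `|` H k))).
  apply: (pr_ae (poisson_ordered theta_poisson)).
  - by apply: mpred_lt; exact: measurable_moved_time.
  - exact: measurableU.
  - move=> w ow; rewrite /moved_time /H /= subnKC ?(ltnW ik) // => h.
    have t0 := ltW (ordered_gt0 i ow); have tk := ltW (ordered_gt0 k ow).
    have h1 := ler_normD (theta i w).2 (B i s w).
    have h2 := lerB_normD (theta k w).2 (B k s w).
    rewrite (ger0_norm t0) in h1; rewrite (ger0_norm tk) in h2.
    have [hi|hi] := leP ((theta k w).2 - (theta i w).2) (2 * `|B i s w|); first by left.
    by right; move: h h1 h2 hi; lra.
apply: (le_trans (prU_le P (mH i) (mH k))).
have := pr_noise_gap i i j0; have := pr_noise_gap i k j0.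
rewrite /H; lra.
Qed.

End Level.
End Inversions.

(** * Independence of the marks and of the new order *)

Section JointUniformity.
Context {R : realType} {V : finType} {G : sgraph V} {d : measure_display}
  {T : measurableType d} (P : probability T R) (p : R)
  (xi : V -> T -> bool) (theta : nat -> T -> dedge G * R) (B : nat -> R -> T -> R).
Hypothesis model : noisy_voter_model P p xi theta B.
Local Notation m := (#|{: dedge G}|%:R : R).
Hypothesis m_gt0 : 0 < m.
Context (L : nat) (s : R) (s_gt0 : 0 < s).

Let theta_poisson := points_poisson model.

Definition marks (w : T) : {ffun 'I_L.+1 -> dedge G} := [ffun k : 'I_L.+1 => (theta k w).1].

Definition times_below (a : 'I_L.+1 -> R) : set T :=
  [set w | forall k : 'I_L.+1, (theta k w).2 < a k].

(** Closed under intersection, by taking minima of the bounds, and generating the first times and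
    the noise; so uniqueness of measures applies. *)
Definition time_noise_events : set (set T) :=
  [set S | exists a N, noise_events B N /\ S = times_below a `&` N].

Lemma mfin_marks : mfin marks.
Proof. by apply: mfin_ffun => k; exact: (mfin_edge theta_poisson). Qed.

Lemma marks_below e a : [set w | marks w = e] `&` times_below a = below_event theta e a.
Proof.
apply/seteqP; split => [w [/= <- h] k|w h]; first by rewrite ffunE.
split => [|k]; last exact: (h k).2.
by apply/ffunP => k; rewrite ffunE (h k).1.
Qed.

Lemma measurable_times_below a : measurable (times_below a).
Proof. by apply: mpred_forall_fin => k; exact: (mpred_time_lt theta_poisson). Qed.

Lemma measurable_marks e : measurable [set w | marks w = e].
Proof. exact: mfin_marks. Qed.

Lemma times_below_eventually w :
  exists M, forall n, (M <= n)%N -> times_below (fun=> n%:R) w.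
Proof.
exists (\max_(k < L.+1) (Num.trunc `|(theta k w).2|).+1)%N => n hn k.
apply: le_lt_trans (ler_norm _) _.
have /truncn_itv/andP[_ h] := normr_ge0 (theta k w).2.
apply: lt_le_trans h _; rewrite ler_nat; apply: leq_trans hn.
exact: (leq_bigmax (F := fun k : 'I_L.+1 => (Num.trunc `|(theta k w).2|).+1)).
Qed.

Lemma pr_marks_equal e f : pr P [set w | marks w = e] = pr P [set w | marks w = f].
Proof.
wlog suff H : e f / pr P [set w | marks w = e] <= pr P [set w | marks w = f].
  by apply/eqP; rewrite eq_le !H.
apply: (pr_liminf (A := fun n => below_event theta e (fun=> n%:R))).
- exact: measurable_marks.
- by move=> n; exact: (measurable_below_event theta_poisson).
- move=> w we; have [M hM] := times_below_eventually w; exists M => n Mn.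
  by rewrite -marks_below; split => //; exact: hM.
- exists 0%N => n _; rewrite (below_event_uniform theta_poisson e f) -marks_below.
  apply: pr_le; last by move=> w [].
    by apply: measurableI; [exact: measurable_marks | exact: measurable_times_below].
  exact: measurable_marks.
Qed.

Lemma pr_marks_times e a :
  pr P (below_event theta e a) = m^-1 ^+ L.+1 * pr P (times_below a).
Proof.
rewrite (pr_partition P (measurable_times_below a) mfin_marks).
rewrite (eq_bigr (fun=> pr P (below_event theta e a))); last first.
  move=> f _; rewrite setIC marks_below.
  exact: (below_event_uniform theta_poisson).
rewrite sumr_const card_ffun card_ord -(mulr_natr (pr P _)) natrX mulrCA -exprMn.
by rewrite mulVf ?gt_eqF // expr1n mulr1.
Qed.

Lemma pr_marks e : pr P [set w | marks w = e] = m^-1 ^+ L.+1.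
Proof.
have := pr_partition P measurableT mfin_marks; rewrite pr_setT.
rewrite (eq_bigr (fun=> pr P [set w | marks w = e])); last first.
  by move=> f _; rewrite setTI; exact: pr_marks_equal.
rewrite sumr_const card_ffun card_ord -(mulr_natr (pr P _)) natrX => h.
have mL : m ^+ L.+1 != 0 by rewrite expf_neq0 // gt_eqF.
by rewrite exprVn; apply: (mulIf mL); rewrite mulVf.
Qed.

Lemma noise_events_measurable N : noise_events B N -> measurable N.
Proof.
apply: smallest_sub; first exact: sigma_algebra_measurable.
move=> A [k _]; apply: smallest_sub; first exact: sigma_algebra_measurable.
move=> {}A [t t0 [I mI <-]].
exact: (brownian_measurable (noise_brownian model k) t0).
Qed.

Lemma below_event_rest (e : 'I_L.+1 -> dedge G) a :
  rest_events xi theta (below_event theta e a).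
Proof.
pose T' := g_sigma_algebraType (sigma_init xi `|` sigma_points theta).
suff h : @mpred _ T' (fun w =>
    forall k : 'I_L.+1, (theta k w).1 = e k /\ (theta k w).2 < a k).
  exact: h.
apply: mpred_forall_fin => k.
have h := points_event (xi := xi) (theta := theta) k
  (slab_measurable (pred1 (e k)) (measurable_itv `]-oo, a k[)).
apply: (@eq_mpred _ T' _ _ _ h) => w; rewrite /slab /= in_itv /=.
by split => [[/eqP]|[/eqP]].
Qed.

Lemma times_below_rest a : rest_events xi theta (times_below a).
Proof.
pose T' := g_sigma_algebraType (sigma_init xi `|` sigma_points theta).
suff h : @mpred _ T' (fun w => forall k : 'I_L.+1, (theta k w).2 < a k) by exact: h.
apply: mpred_forall_fin => k.
have h := points_event (xi := xi) (theta := theta) k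
  (slab_measurable predT (measurable_itv `]-oo, a k[)).
by apply: (@eq_mpred _ T' _ _ _ h) => w; rewrite /slab /= in_itv /=; split => [[]|].
Qed.

(** Both sides are finite measures in [S]. On the generators the noise splits off by independence,
    and for times bounded by [a] the claim is [pr_marks_times]. *)
Lemma marks_uniform e S : <<s time_noise_events >> S ->
  pr P ([set w | marks w = e] `&` S) = m^-1 ^+ L.+1 * pr P S.
Proof.
move=> sS; have c0 : 0 <= m^-1 ^+ L.+1 by rewrite exprn_ge0 // invr_ge0.
have mTN A : time_noise_events A -> measurable A.
  move=> [a [N [/noise_events_measurable mN ->]]].
  by apply: measurableI => //; exact: measurable_times_below.
have mS : measurable S.
  by move: S sS; apply: smallest_sub => //; exact: sigma_algebra_measurable.
have mE := measurable_marks e.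
have := @g_sigma_algebra_measure_unique_trace _ R T time_noise_events setT measurableT
  _ _ (mrestr P mE) (mscale (NngNum c0) P).
rewrite (_ : [set X | time_noise_events X /\ X `<=` setT] = time_noise_events); last first.
  by apply/seteqP; split => [X []//|X]; split.
move=> /(_ mTN) H.
have {}H := H _ _ _ _ _ S sS.
have : mrestr P mE S = mscale (NngNum c0) P S.
  apply: H.
  - move=> X Y [a [N [sN ->]]] [b [N' [sN' ->]]].
    exists (fun k => Num.min (a k) (b k)), (N `&` N'); split.
      exact: (@measurableI _ (g_sigma_algebraType (\bigcup_k sigma_path (B k)))).
    rewrite setIACA; congr (_ `&` _); apply/seteqP; split => w.
      by move=> [h1 h2] k; rewrite lt_min h1 h2.
    by move=> h; split => k; have := h k; rewrite lt_min => /andP[].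
  - rewrite -[LHS]/(P (setT `&` [set w | marks w = e])) setTI (prE P mE) pr_marks.
    by rewrite -[RHS]/((m^-1 ^+ L.+1)%:E * P setT)%E probability_setT mule1.
  - move=> X [a [N [sN ->]]].
    have mN := noise_events_measurable sN.
    rewrite -[LHS]/(P (times_below a `&` N `&` [set w | marks w = e])).
    rewrite -[RHS]/((m^-1 ^+ L.+1)%:E * P (times_below a `&` N))%E.
    have -> : times_below a `&` N `&` [set w | marks w = e] = N `&` below_event theta e a.
      by rewrite -marks_below setIC setIA setIC.
    rewrite (noise_rest_independent model sN (below_event_rest e a)).
    rewrite setIC (noise_rest_independent model sN (times_below_rest a)).
    rewrite (prE P (measurable_below_event theta_poisson e a)) pr_marks_times.
    by rewrite EFinM -(prE P (measurable_times_below a)) muleCA.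
  - rewrite -[ltLHS]/(P (setT `&` [set w | marks w = e])) setTI.
    by rewrite (prE P mE) ltry.
  - by [].
move=> /(congr1 fine).
rewrite -[LHS]/(pr P (S `&` [set w | marks w = e])) setIC => ->.
rewrite -[LHS]/(fine ((m^-1 ^+ L.+1)%:E * P S)%E).
by rewrite fineM ?fin_num_measure.
Qed.

(** All that sorting the moved points depends on, as a random variable with finitely many values. *)
Definition pattern (w : T) : {ffun 'I_L.+1 * 'I_L.+1 -> bool} :=
  [ffun ij : 'I_L.+1 * 'I_L.+1 => moved_time theta B s ij.1 w <= moved_time theta B s ij.2 w].

Local Notation T' := (g_sigma_algebraType time_noise_events).

Lemma time_noise_event a N : noise_events B N ->
  <<s time_noise_events >> (times_below a `&` N).
Proof. by move=> hN; apply: sub_sigma_algebra; exists a, N. Qed.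

(** Generators carry a time bound; it disappears in the union over all bounds. *)
Lemma noise_time_noise N : noise_events B N -> <<s time_noise_events >> N.
Proof.
move=> hN; have -> : N = \bigcup_n (times_below (fun=> n%:R) `&` N).
  apply/seteqP; split => [w Nw|w [n _ []//]].
  by have [n nw] := times_below_eventually w; exists n => //; split => //; exact: nw.
apply: (@bigcupT_measurable _ T') => n; exact: time_noise_event.
Qed.

Lemma time_time_noise (k : 'I_L.+1) : measurable_fun setT (fun w : T' => (theta k w).2).
Proof.
apply: (@measurability _ _ T' R setT _ (@RGenInftyO.G R)).
  exact: RGenInftyO.measurableE.
move=> _ [_ [x ->] <-]; rewrite setTI.
pose a n (i : 'I_L.+1) : R := if i == k then x else n%:R.
have -> : (fun w : T' => (theta k w).2) @^-1` `]-oo, x[ =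
    \bigcup_n (times_below (a n) `&` setT).
  apply/seteqP; split => [w /= |w [n _ [/(_ k)]]]; rewrite /= in_itv /= /a ?eqxx //.
  move=> kx; have [n nw] := times_below_eventually w.
  by exists n => //; split => // i; rewrite /a; case: eqP => [-> //|_]; exact: nw.
apply: (@bigcupT_measurable _ T') => n; apply: time_noise_event.
exact: (@measurableT _ (g_sigma_algebraType (\bigcup_k sigma_path (B k)))).
Qed.

Lemma moved_time_noise (k : 'I_L.+1) :
  measurable_fun setT (fun w : T' => moved_time theta B s k w).
Proof.
have mB : measurable_fun setT (fun w : T' => B k s w).
  move=> _ I mI; rewrite setTI; apply: noise_time_noise.
  by apply: noise_event => //; exact: ltW.
have mf : measurable_fun setT (fun w : T' => (theta k w).2 + B k s w).
  by apply: measurable_funD => //; exact: time_time_noise.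
by rewrite /moved_time; apply: measurableT_comp.
Qed.

Lemma mfin_pattern : @mfin _ T' _ pattern.
Proof.
apply: mfin_ffun => -[i j] /=; apply: (@mfin_bool _ T').
by apply: (@mpred_le _ T'); exact: moved_time_noise.
Qed.

Lemma pr_marks_pattern e z :
  pr P ([set w | marks w = e] `&` [set w | pattern w = z]) =
  m^-1 ^+ L.+1 * pr P [set w | pattern w = z].
Proof. by apply: marks_uniform; exact: mfin_pattern. Qed.

End JointUniformity.

(** * Comparison of the two outcomes *)

Section SortingLimit.
Context {R : realDomainType} (t : nat -> R).

Definition time_le : rel nat := fun i j => t i <= t j.

Definition increasing_enum (sigma : nat -> nat) : Prop :=
  bijective sigma /\ {homo (fun k => t (sigma k)) : i j / (i < j)%N >-> i < j}.

Lemma time_le_trans : transitive time_le.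
Proof. by move=> i j k; exact: le_trans. Qed.

Lemma time_le_total : total time_le.
Proof. by move=> i j; exact: le_total. Qed.

Lemma increasing_enum_inj sigma : increasing_enum sigma -> injective t.
Proof.
move=> [[g sg gs] h] i j tij; rewrite -(gs i) -(gs j); congr sigma.
case: (ltngtP (g i) (g j)) => // /h; rewrite !gs tij ltxx //.
Qed.

(** Sorting the first [n] points gives [sigma] restricted to values below [n]; when all [sigma x]
    with [x < J] are below [n], the restriction leaves the head intact. *)
Lemma take_isort_enum sigma J : increasing_enum sigma -> exists M,
  forall n, (M <= n)%N -> take J (isort time_le n) = [seq sigma i | i <- iota 0 J].
Proof.
move=> hs; have tinj := increasing_enum_inj hs; have [bs ht] := hs.
have sinj := bij_inj bs; have [g sg gs] := bs.
exists (\max_(x < J) (sigma x).+1)%N => n Mn.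
have sJ x : (x < J)%N -> (sigma x < n)%N.
  move=> xJ; apply: leq_trans Mn.
  exact: (leq_bigmax (F := fun x : 'I_J => (sigma x).+1) (Ordinal xJ)).
pose N := maxn J (\max_(i < n) (g i).+1)%N.
have gN i : (i < n)%N -> (g i < N)%N.
  move=> iN; rewrite leq_max; apply/orP; right.
  exact: (leq_bigmax (F := fun i : 'I_n => (g i).+1) (Ordinal iN)).
have -> : isort time_le n = [seq sigma x | x <- iota 0 N & (sigma x < n)%N].
  apply: (@sorted_eq _ time_le).
  - exact: time_le_trans.
  - by move=> i j /le_anti/tinj.
  - by apply: isort_sorted; [exact: time_le_trans | exact: time_le_total].
  - rewrite sorted_map; apply: (@sub_sorted _ ltn).
      by move=> i j ij; rewrite /= /time_le ltW // ht.
    by apply: sorted_filter; [exact: ltn_trans | exact: iota_ltn_sorted].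
  - apply: uniq_perm; first exact: isort_uniq.
      by rewrite map_inj_uniq // filter_uniq // iota_uniq.
    move=> i; rewrite mem_isort; apply/idP/mapP => [iN|[x]].
      by exists (g i); rewrite ?gs // mem_filter gs iN mem_iota /= gN.
    by rewrite mem_filter => /andP[h _] ->.
have JN : (J <= N)%N by rewrite leq_maxl.
rewrite -(subnKC JN) iotaD filter_cat map_cat.
have -> : [seq x <- iota 0 J | (sigma x < n)%N] = iota 0 J.
  by apply/all_filterP/allP => x; rewrite mem_iota => /sJ.
by rewrite take_size_cat // size_map size_iota.
Qed.

(** A substitute for the existence of an increasing enumeration that uses countable quantifiers
    only, hence is measurable. The limit order exists by the second clause; the third one forbids
    points that are pushed back forever. *)
Definition sorting_stabilizes : Prop := [/\ injective t,
  forall a, exists b M, forall n, (M <= n)%N -> nth 0%N (isort time_le n) a = b &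
  forall k, exists a M, forall n, (M <= n)%N -> nth 0%N (isort time_le n) a = k].

Lemma increasing_enum_stabilizes :
  (exists sigma, increasing_enum sigma) <-> sorting_stabilizes.
Proof.
split=> [[sigma hs]|[tinj hb hc]].
  have H a : exists M, forall n, (M <= n)%N -> nth 0%N (isort time_le n) a = sigma a.
    have [M hM] := take_isort_enum a.+1 hs; exists M => n /hM tk.
    rewrite -(nth_take (n0 := a.+1)) // tk (nth_map 0%N) ?size_iota //.
    by rewrite nth_iota.
  split; first exact: increasing_enum_inj hs.
    by move=> a; exists (sigma a); exact: H.
  by move=> k; have [g _ gs] := hs.1; exists (g k); rewrite -{2}(gs k); exact: H.
have [sigma hsig] := choice hb.
have mono : {homo (fun k => t (sigma k)) : i j / (i < j)%N >-> i < j}.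
  move=> i j ij; have [M1 h1] := hsig i; have [M2 h2] := hsig j.
  pose n := maxn j.+1 (maxn M1 M2).
  have jn : (j < n)%N by rewrite /n leq_max leqnn.
  have in_ : (i < n)%N by exact: ltn_trans jn.
  rewrite -(h1 n) ?leq_max ?leqnn ?orbT // -(h2 n) ?leq_max ?leqnn ?orbT //.
  rewrite lt_neqAle; apply/andP; split.
    rewrite (inj_eq tinj) nth_uniq ?size_isort ?isort_uniq //.
    by rewrite ltn_eqF.
  apply: (sorted_ltn_nth time_le_trans 0%N (isort_sorted n time_le_trans time_le_total)) => //.
    by rewrite inE size_isort.
  by rewrite inE size_isort.
have sinj : injective sigma.
  move=> i j sij; case: (ltngtP i j) => // /mono; rewrite sij ltxx //.
have ssurj k : exists a, sigma a = k.
  have [a [M h]] := hc k; have [M' h'] := hsig a; exists a.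
  by rewrite -(h' (maxn M M')) ?leq_maxr // h // leq_maxl.
have [g hg] := choice ssurj.
by exists sigma; split => //; exists g => // i; apply: sinj; rewrite hg.
Qed.

End SortingLimit.

Section GeometricSums.
Context {R : realFieldType} (rho : R).

Lemma geometric_above q n :
  (1 - rho) * \sum_(k < n) (q < k)%N%:R * rho ^+ (k - q.+1) = 1 - rho ^+ (n - q.+1).
Proof.
elim: n => [|n IH]; first by rewrite big_ord0 mulr0 expr0 subrr.
rewrite big_ord_recr /= mulrDr IH; case: (ltnP q n) => qn.
  by rewrite mul1r subSn // exprS; ring.
have -> : (n - q.+1 = 0)%N by apply/eqP; rewrite subn_eq0 ltnW.
have -> : (n.+1 - q.+1 = 0)%N by apply/eqP; rewrite subn_eq0.
by rewrite mul0r mulr0 addr0.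
Qed.

Lemma geometric_below q n :
  (1 - rho) * \sum_(l < n) (l <= q)%N%:R * rho ^+ (q - l) =
  rho ^+ (q.+1 - n) - rho ^+ q.+1.
Proof.
elim: n => [|n IH]; first by rewrite big_ord0 mulr0 subn0 subrr.
rewrite big_ord_recr /= mulrDr IH; case: (leqP n q) => qn.
  by rewrite mul1r subSS subSn // exprS; ring.
have -> : (q.+1 - n = 0)%N by apply/eqP; rewrite subn_eq0.
have -> : (q.+1 - n.+1 = 0)%N by apply/eqP; rewrite subn_eq0 ltnW.
by rewrite mul0r mulr0 addr0.
Qed.

(** For [l <= q < k] the exponent is [1 + (k - q.+1) + (q - l)], so the double sum splits into two
    geometric ones. *)
Lemma crossing_sum q n : 0 <= rho -> rho < 1 ->
  \sum_(k < n) \sum_(l < n) (l <= q < k)%N%:R * rho ^+ (k - l) <=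
  rho / (1 - rho) ^+ 2.
Proof.
move=> r0 r1; have r10 : 0 < 1 - rho by rewrite subr_gt0.
have -> : \sum_(k < n) \sum_(l < n) (l <= q < k)%N%:R * rho ^+ (k - l) =
   rho * ((\sum_(k < n) (q < k)%N%:R * rho ^+ (k - q.+1)) *
          (\sum_(l < n) (l <= q)%N%:R * rho ^+ (q - l))).
  rewrite big_distrlr /= mulr_sumr; apply: eq_bigr => k _.
  rewrite mulr_sumr; apply: eq_bigr => l _.
  case: (leqP l q) => lq; case: (ltnP q k) => qk /=; rewrite ?mul0r ?mulr0 ?mul1r //.
  rewrite -exprD -exprS; congr (_ ^+ _); move: lq qk; lia.
rewrite ler_wpM2l // expr2 invfM; apply: ler_pM.
- by apply: sumr_ge0 => k _; rewrite mulr_ge0 ?exprn_ge0.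
- by apply: sumr_ge0 => k _; rewrite mulr_ge0 ?exprn_ge0.
- rewrite -[leRHS]mulr1 ler_pdivlMl // geometric_above.
  by rewrite gerBl exprn_ge0.
- rewrite -[leRHS]mulr1 ler_pdivlMl // geometric_below.
  rewrite lerBlDr; apply: le_trans (exprn_ile1 _ r0 (ltW r1)) _.
  by rewrite lerDl exprn_ge0.
Qed.

End GeometricSums.

Section Comparison.
Context {R : realType} {V : finType} {G : sgraph V} {d : measure_display}
  {T : measurableType d} (P : probability T R) (p : R)
  (xi : V -> T -> bool) (theta : nat -> T -> dedge G * R) (B : nat -> R -> T -> R).
Hypothesis model : noisy_voter_model P p xi theta B.
Local Notation m := (#|{: dedge G}|%:R : R).
Hypothesis m_gt0 : 0 < m.
Context (e0 : dedge G) (s : R) (s_gt0 : 0 < s).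

Let theta_poisson := points_poisson model.

Definition earlier (w : T) : rel nat := time_le (fun k => moved_time theta B s k w).

Definition edge_list (w : T) (n : nat) : seq (dedge G) :=
  [seq (theta k w).1 | k <- iota 0 n].

Definition sorted_indices (w : T) (n : nat) : seq nat := isort (earlier w) n.

Section Level.
Context (J L : nat) (JL : (J <= L.+1)%N).
Local Notation K := L.+1.
Local Notation pat := (pattern theta B L s).
Local Notation mar := (marks theta L).

Definition pattern_rel (z : {ffun 'I_K * 'I_K -> bool}) : rel nat :=
  fun i j => z (inord i, inord j).

Definition ffun_list (e : {ffun 'I_K -> dedge G}) : seq (dedge G) :=
  [seq e k | k <- enum 'I_K].

Lemma edge_list_marks w : edge_list w K = ffun_list (mar w).
Proof.
rewrite /edge_list /ffun_list -val_enum_ord -map_comp.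
by apply: eq_map => k; rewrite /= ffunE.
Qed.

Lemma sorted_indices_pattern w :
  sorted_indices w K = isort (pattern_rel (pat w)) K.
Proof.
apply: eq_isort => i j iK jK.
by rewrite /pattern_rel ffunE /= !inordK.
Qed.

Lemma sum_ffun_list (F : seq (dedge G) -> R) :
  \sum_(t : K.-tuple (dedge G)) F t = \sum_(e : {ffun 'I_K -> dedge G}) F (ffun_list e).
Proof.
have h : bijective (fun e : {ffun 'I_K -> dedge G} => [tuple e k | k < K]).
  exists (fun t : K.-tuple (dedge G) => [ffun k => tnth t k]) => [e|t].
    by apply/ffunP => k; rewrite ffunE tnth_mktuple.
  by apply: eq_from_tnth => k; rewrite tnth_mktuple ffunE.
by rewrite (reindex _ (onW_bij _ h)).
Qed.

Definition differ_event : set T :=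
  [set w | may_differ e0 J (edge_list w K) (sorted_indices w K)].

Lemma mfin_pat : mfin pat.
Proof.
apply: mfin_ffun => -[i j] /=; apply: mfin_bool.
by apply: mpred_le; exact: (measurable_moved_time model).
Qed.

Lemma measurable_differ_event : measurable differ_event.
Proof.
pose Q (y : {ffun 'I_K -> dedge G} * {ffun 'I_K * 'I_K -> bool}) : Prop :=
  may_differ e0 J (ffun_list y.1) (isort (pattern_rel y.2) K).
have mm : mfin mar by exact: (mfin_marks model).
apply: eq_mpred (mfin_pred Q (mfin_pair mm mfin_pat)) => w.
by rewrite /differ_event /mkset edge_list_marks sorted_indices_pattern.
Qed.

(** Given its pattern, the new order is a fixed list while the marks remain uniform; this is where
    the random order becomes deterministic. *)
Lemma pr_differ_pattern z : pr P (differ_event `&` [set w | pat w = z]) =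
  pr P [set w | pat w = z] *
  mean K (fun ws => (may_differ e0 J ws (isort (pattern_rel z) K))%:R).
Proof.
have mz : measurable [set w | pat w = z] by exact: mfin_pat.
have mm : mfin mar by exact: (mfin_marks model).
rewrite (pr_partition P (measurableI _ _ measurable_differ_event mz) mm).
rewrite mean_tuple (sum_ffun_list (fun ws => (may_differ e0 J ws _)%:R)) mulrCA mulrA.
rewrite mulr_sumr; apply: eq_bigr => e _.
rewrite -(pr_marks_pattern model m_gt0 s_gt0 e z).
case: (boolP (may_differ _ _ _ _)) => md; rewrite ?mulr1 ?mulr0.
  congr pr; apply/seteqP; split => w; first by case=> -[].
  move=> [/= we wz]; split => //; split => //.
  by rewrite /differ_event /mkset edge_list_marks sorted_indices_pattern we wz.
rewrite (_ : _ `&` _ = set0) ?pr_set0 //; apply/seteqP; split => // w [[]].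
rewrite /differ_event /mkset edge_list_marks sorted_indices_pattern => h wz we.
by move: md; rewrite -we -wz h.
Qed.

Lemma pr_pattern_mean (Q : pred {ffun 'I_K * 'I_K -> bool}) :
  \sum_z pr P [set w | pat w = z] * (Q z)%:R = pr P [set w | Q (pat w)].
Proof.
have mQ : measurable [set w | Q (pat w)].
  exact: (mfin_pred (fun z => Q z : Prop) mfin_pat).
rewrite (pr_partition P mQ mfin_pat); apply: eq_bigr => z _.
case: (boolP (Q z)) => Qz; rewrite ?mulr1 ?mulr0.
  by congr pr; apply/seteqP; split => [w wz|w []//]; split => //=; rewrite wz.
rewrite (_ : _ `&` _ = set0) ?pr_set0 //; apply/seteqP; split => // w [/= + wz].
by rewrite wz (negPf Qz).
Qed.

Definition crossing (q : nat) (z : {ffun 'I_K * 'I_K -> bool}) : R :=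
  \sum_(k < K) \sum_(l < K) ((l <= q < k)%N && ~~ z (l, k))%:R.

Local Notation fail := (mean J (fun ws : seq (dedge G) =>
  (~~ unanimous (run (id : V -> V) ws))%:R) : R).

Lemma mean_may_differ_pattern w :
  mean K (fun ws => (may_differ e0 J ws (isort (pattern_rel (pat w)) K))%:R) <=
  2 * fail + #|V|%:R^-1 * \sum_(q < K) swap_cost (R := R) (G := G) q * crossing q (pat w).
Proof.
rewrite -sorted_indices_pattern.
apply: (le_trans (mean_may_differ e0 m_gt0 JL (perm_isort _ _))).
rewrite lerD2l ler_wpM2l ?invr_ge0 //.
apply: (le_trans (mean_diff_isort e0 m_gt0 K (@time_le_trans _ _) (@time_le_total _ _))).
apply: ler_sum => q _; rewrite ler_wpM2l ?swap_cost_ge0 //.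
rewrite /crossing; apply: ler_sum => k _; apply: ler_sum => l _.
by rewrite ffunE.
Qed.

Lemma pr_crossing q : \sum_z pr P [set w | pat w = z] * crossing q z <=
  inversion_const * (inversion_rate (G := G) s / (1 - inversion_rate (G := G) s) ^+ 2).
Proof.
rewrite /crossing.
under eq_bigr do rewrite mulr_sumr.
rewrite exchange_big /=.
under eq_bigr do under eq_bigr do rewrite mulr_sumr.
under eq_bigr do rewrite exchange_big /=.
have rate0 : 0 <= inversion_rate (G := G) s.
  by rewrite divr_ge0 ?addr_ge0 ?mulr_ge0 ?sqrtr_ge0.
have rate1 : inversion_rate (G := G) s < 1.
  rewrite ltr_pdivrMr ?mul1r ?ltrDr ?ltr_wpDl // ?mulr_gt0 ?sqrtr_gt0 //.
have c0 : 0 <= inversion_const :> R by rewrite mulr_ge0 ?expR_ge0.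
apply: (@le_trans _ _ (inversion_const *
   \sum_(k < K) \sum_(l < K) (l <= q < k)%N%:R * inversion_rate (G := G) s ^+ (k - l))); last first.
  by rewrite ler_wpM2l // crossing_sum.
rewrite mulr_sumr; apply: ler_sum => k _; rewrite mulr_sumr; apply: ler_sum => l _.
rewrite (pr_pattern_mean (fun z => (l <= q < k)%N && ~~ z (l, k))).
case: (boolP (l <= q < k)%N) => [/andP[lq qk]|_] /=; last first.
  rewrite [X in pr _ X](_ : _ = set0) ?pr_set0 ?mul0r ?mulr0 //.
  by apply/seteqP; split.
rewrite mul1r; apply: le_trans (pr_inversion model m_gt0 s_gt0 (leq_ltn_trans lq qk)).
rewrite le_eqVlt; apply/orP; left; apply/eqP; congr pr.
by apply/seteqP; split => w /=; rewrite ffunE /= -ltNge.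
Qed.

(** The bound is uniform in the number of points: the swap costs are summable over positions, and
    the mean crossings are bounded at each position. *)
Lemma pr_differ_event : (0 < #|V|)%N -> m * Num.sqrt s <= 1 ->
  pr P differ_event <=
  2 * fail + 12 * inversion_const * #|V|%:R * (max_degree G)%:R * Num.sqrt s.
Proof.
move=> V0 eps1; rewrite (pr_partition P measurable_differ_event mfin_pat).
have n0 : 0 < #|V|%:R :> R by rewrite ltr0n.
apply: (@le_trans _ _ (\sum_z pr P [set w | pat w = z] *
   (2 * fail + #|V|%:R^-1 * \sum_(q < K) swap_cost (R := R) (G := G) q * crossing q z))).
  apply: ler_sum => z _; rewrite pr_differ_pattern.
  (* A pattern that occurs comes from a total order, as the sorting bound requires; the others
     contribute zero. *)
  have [[w <-]|nw] := pselect (exists w, pat w = z).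
    by rewrite ler_wpM2l ?pr_ge0 // mean_may_differ_pattern.
  rewrite (_ : [set w | pat w = z] = set0) ?pr_set0 ?mul0r //.
  by apply/seteqP; split => // w wz; apply: nw; exists w.
under eq_bigr do rewrite mulrDr.
rewrite big_split /= -mulr_suml.
have -> : \sum_z pr P [set w | pat w = z] = 1.
  rewrite -(pr_setT P) (pr_partition P measurableT mfin_pat).
  by apply: eq_bigr => z _; rewrite setTI.
rewrite mul1r lerD2l.
under eq_bigr do rewrite mulrCA mulr_sumr.
rewrite -mulr_sumr exchange_big /=.
under eq_bigr do under eq_bigr do rewrite mulrCA.
under eq_bigr do rewrite -mulr_sumr.
set sigma := Num.sqrt s; set D : R := (max_degree G)%:R; set n : R := #|V|%:R.
set C := inversion_const.
have s0 : 0 <= sigma by exact: sqrtr_ge0.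
have C0 : 0 <= C by rewrite mulr_ge0 ?expR_ge0.
have rateE : inversion_rate (G := G) s / (1 - inversion_rate (G := G) s) ^+ 2 =
    m * sigma * (1 + m * sigma).
  rewrite /inversion_rate -/sigma.
  have e1 : 0 < 1 + m * sigma by rewrite ltr_wpDr ?mulr_ge0.
  move: (m * sigma) e1 => y y1; have y10 : y + 1 != 0 by rewrite addrC gt_eqF.
  rewrite (addrC 1); have -> : 1 - y / (y + 1) = (y + 1)^-1 by field.
  by field.
have H : \sum_(q < K) swap_cost (R := R) (G := G) q *
    (\sum_z pr P [set w | pat w = z] * crossing q z) <=
    12 * D / m ^+ 2 * (m * n ^+ 2 / 2) * (C * (m * sigma * (1 + m * sigma))).
  apply: (@le_trans _ _ (\sum_(q < K) swap_cost (R := R) (G := G) q *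
      (C * (m * sigma * (1 + m * sigma))))).
    apply: ler_sum => q _; rewrite ler_wpM2l ?swap_cost_ge0 //.
    by rewrite -rateE; exact: pr_crossing.
  rewrite -mulr_suml ler_wpM2r ?mulr_ge0 ?addr_ge0 ?mulr_ge0 //.
  rewrite /swap_cost -mulr_sumr ler_wpM2l ?mulr_ge0 ?invr_ge0 ?exprn_ge0 //.
  by have := sum_mean_discord m_gt0 (id : V -> V) K; rewrite natrX.
apply: (@le_trans _ _ (n^-1 * (12 * D / m ^+ 2 * (m * n ^+ 2 / 2) *
    (C * (m * sigma * (1 + m * sigma)))))).
  by rewrite ler_wpM2l ?invr_ge0.
have -> : n^-1 * (12 * D / m ^+ 2 * (m * n ^+ 2 / 2) * (C * (m * sigma * (1 + m * sigma)))) =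
   6 * C * n * D * sigma * (1 + m * sigma).
  by field; rewrite !gt_eqF.
(* The assumption [m * Num.sqrt s <= 1] bounds the last factor by 2, which turns the constant 6 into
   12. *)
have : 6 * C * n * D * sigma * (1 + m * sigma) <= 6 * C * n * D * sigma * 2.
  by rewrite ler_wpM2l ?mulr_ge0 //; move: eps1; rewrite -/sigma; lra.
by move/le_trans; apply; rewrite le_eqVlt; apply/orP; left; apply/eqP; ring.
Qed.

End Level.
End Comparison.

(** * Consensus in terms of finite lists of edges *)

Section Consensus.
Context {R : realType} {V : finType} {G : sgraph V}.
Implicit Types (xi : V -> bool) (th : nat -> dedge G * R).

Lemma voter_run xi th k : voter xi th k = run xi [seq (th i).1 | i <- iota 0 k].
Proof.
elim: k => // k IH.
rewrite -addn1 iotaD map_cat run_cat -IH addn1 /=.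
by apply/funext => v; rewrite /voter_step /step /= /origin /target /source; case: eqP.
Qed.

(** Lengths [k.+1], since [marks] and [pattern] describe the first [L.+1] points. *)
Definition eventually_all xi th (b : bool) : Prop := exists N, forall k, (N <= k)%N ->
  forall v, run xi [seq (th i).1 | i <- iota 0 k.+1] v = b.

Lemma near_eventually_all xi th b :
  (\forall k \near \oo, forall v, voter xi th k v = b) <-> eventually_all xi th b.
Proof.
split=> [[N _ h]|[N h]].
  by exists N => k Nk v; rewrite -voter_run; apply: h => /=; exact: leqW.
exists N.+1 => // -[//|k] Nk v; rewrite voter_run; exact: h.
Qed.

Lemma consensus_eventually (v0 : V) xi th b :
  eventually_all xi th b -> consensus xi th = b.
Proof.
move=> h; rewrite /consensus; apply: xget_subset1; first exact/near_eventually_all.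
move=> b1 b2 /near_eventually_all[N1 h1] /near_eventually_all[N2 h2].
by rewrite -(h1 (maxn N1 N2) (leq_maxl _ _) v0) -(h2 (maxn N1 N2) (leq_maxr _ _) v0).
Qed.

(** The default of [consensus] is [false], so [true] can only stem from real agreement; this yields
    a description with countable quantifiers. *)
Lemma consensus_trueE (v0 : V) xi th :
  consensus xi th = true <-> eventually_all xi th true.
Proof.
split; last exact: consensus_eventually.
rewrite /consensus; case: xgetP => // b _ /= h <-; exact/near_eventually_all.
Qed.

Lemma eq_consensus (v0 : V) xi th th' : (forall k, (th k).1 = (th' k).1) ->
  consensus xi th = consensus xi th'.
Proof.
move=> h.
have H b : eventually_all xi th b <-> eventually_all xi th' b.
  by split => -[N hN]; exists N => k Nk v; [rewrite -(eq_map h) | rewrite (eq_map h)]; exact: hN.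
have E : consensus xi th = true <-> consensus xi th' = true.
  by split => /(consensus_trueE v0)/H/(consensus_trueE v0).
by apply/idP/idP => /E.
Qed.

Lemma consensus_winner (u : V) xi th N :
  (forall v, run (id : V -> V) [seq (th i).1 | i <- iota 0 N] v = u) ->
  consensus xi th = xi u.
Proof.
move=> h; apply: (consensus_eventually u); exists N => k Nk v.
rewrite -(subnKC (leqW Nk)) iotaD map_cat run_cat.
have uN : unanimous (run xi [seq (th i).1 | i <- iota 0 N]).
  by apply/unanimousP => x y; rewrite (run_comp xi id) /= !h.
by rewrite unanimous_run // (run_comp xi id) /= h.
Qed.

End Consensus.

(** * Measurability of the outcomes and the final limit *)

Section NoiseSensitivity.
Context {R : realType} {V : finType} {G : sgraph V} {d : measure_display}
  {T : measurableType d} (P : probability T R) (p : R)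
  (xi : V -> T -> bool) (theta : nat -> T -> dedge G * R) (B : nat -> R -> T -> R).
Hypothesis model : noisy_voter_model P p xi theta B.
Local Notation m := (#|{: dedge G}|%:R : R).
Hypothesis m_gt0 : 0 < m.
Context (e0 : dedge G) (s : R) (s_gt0 : 0 < s).

Let theta_poisson := points_poisson model.
Let v0 : V := source e0.
Local Notation moved w := (fun k => moved_time theta B s k w).

(** In the second case [reorder] falls back on [idfun], the marks keep their order, and the outcome
    is unchanged. *)
Lemma perturb_edges w :
  (exists2 sigma, increasing_enum (moved w) sigma &
     forall k, (perturb theta B s w k).1 = (theta (sigma k) w).1) \/
  ~ (exists sigma, increasing_enum (moved w) sigma) /\
  (forall k, (perturb theta B s w k).1 = (theta k w).1).
Proof.
have [ex|nex] := pselect (exists sigma, increasing_enum (moved w) sigma).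
  left; have := xgetPex (idfun : nat -> nat) ex.
  by set sigma := xget _ _ => hs; exists sigma.
right; split => // k.
rewrite /perturb /reorder xgetPN // => sigma hs; apply: nex; by exists sigma.
Qed.

Definition outcome_changed : set T :=
  [set w | consensus (xi ^~ w) (theta ^~ w) <>
           consensus (xi ^~ w) (perturb theta B s w)].

Lemma perturb_edge_list w sigma J :
  increasing_enum (moved w) sigma ->
  (forall k, (perturb theta B s w k).1 = (theta (sigma k) w).1) ->
  exists M, forall n, (M <= n)%N ->
  take J [seq nth e0 (edge_list theta w n) i | i <- sorted_indices theta B s w n] =
  [seq (perturb theta B s w i).1 | i <- iota 0 J].
Proof.
move=> hs hp; have [M hM] := take_isort_enum J hs; exists M => n Mn.
rewrite (eq_map hp) (map_comp (fun k => (theta k w).1) sigma) -(hM n Mn) -map_take.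
apply/eq_in_map => i /mem_take; rewrite mem_isort => ni.
by rewrite (nth_map 0%N) ?size_iota // nth_iota.
Qed.

(** If both heads have winners, these are different vertices, since equal ones would give the same
    outcome; the runs keep their winners, so they disagree to the end. *)
Lemma outcome_changed_differ w J : outcome_changed w ->
  exists M, forall L, (M <= L)%N -> differ_event theta B e0 s J L w.
Proof.
rewrite /outcome_changed /= => changed.
have [[sigma hs hp]|[_ hp]] := perturb_edges w; last first.
  by case: changed; apply: (eq_consensus v0) => k; rewrite hp.
have [M hM] := perturb_edge_list J hs hp.
exists (maxn J M) => L; rewrite geq_max => /andP[JL ML].
have {hM} hM := hM L.+1 (leqW ML).
rewrite /differ_event /mkset /may_differ hM.
set ws := edge_list theta w L.+1; set ws' := [seq nth e0 ws i | i <- _] in hM *.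
have tJ : take J ws = [seq (theta i w).1 | i <- iota 0 J].
  by rewrite /ws /edge_list -map_take take_iota (minn_idPl _) // leqW.
rewrite tJ.
have [u1|//] := boolP (unanimous (run id [seq (theta i w).1 | i <- iota 0 J])).
have [u2|//] := boolP (unanimous (run id [seq (perturb theta B s w i).1 | i <- iota 0 J])).
apply/or3P/Or33.
pose u := run id [seq (theta i w).1 | i <- iota 0 J] v0.
pose u' := run id [seq (perturb theta B s w i).1 | i <- iota 0 J] v0.
have c1 : consensus (xi ^~ w) (theta ^~ w) = xi u w.
  by apply: (@consensus_winner R V G u (xi ^~ w) _ J) => v; exact: (unanimousP _ u1).
have c2 : consensus (xi ^~ w) (perturb theta B s w) = xi u' w.
  by apply: (@consensus_winner R V G u' (xi ^~ w) _ J) => v; exact: (unanimousP _ u2).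
have uu' : u != u' by apply: contra_not_neq changed; rewrite c1 c2 => ->.
have r1 : run id ws v0 = u.
  by rewrite -(cat_take_drop J ws) run_cat tJ unanimous_run.
have r2 : run id ws' v0 = u'.
  by rewrite -(cat_take_drop J ws') run_cat hM unanimous_run.
by rewrite -lt0n /disagreements (bigD1 v0) // r1 r2 uu'.
Qed.

Section Finite.
Variable L : nat.
Local Notation data := ({ffun V -> bool} *
  ({ffun 'I_L.+1 -> dedge G} * {ffun 'I_L.+1 * 'I_L.+1 -> bool}))%type.

Definition model_data (w : T) : data :=
  ([ffun v => xi v w], (marks theta L w, pattern theta B L s w)).

Lemma mfin_data : mfin model_data.
Proof.
apply: mfin_pair; last by apply: mfin_pair; [exact: (mfin_marks model) | exact: (mfin_pat model)].
apply: mfin_ffun => v; apply: mfin_bool.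
have := init_measurable model v measurableT => /(_ [set true] I).
by rewrite setTI.
Qed.

Lemma mpred_run v : mpred (fun w => run (xi ^~ w) (edge_list theta w L.+1) v).
Proof.
apply: eq_mpred (mfin_pred (fun y : data => run y.1 (ffun_list y.2.1) v : Prop) mfin_data) => w.
rewrite /= -edge_list_marks (_ : (fun_of_fin [ffun v => xi v w]) = (xi ^~ w)) //.
by apply/funext => x; rewrite ffunE.
Qed.

Lemma mpred_run_sorted k v : mpred (fun w => run (xi ^~ w)
  (take k [seq nth e0 (edge_list theta w L.+1) i | i <- sorted_indices theta B s w L.+1]) v).
Proof.
apply: eq_mpred (mfin_pred (fun y : data => run y.1 (take k
   [seq nth e0 (ffun_list y.2.1) i | i <- isort (pattern_rel y.2.2) L.+1]) v : Prop) mfin_data) => w.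
rewrite [model_data w]lock; rewrite edge_list_marks sorted_indices_pattern -lock.
rewrite (_ : (xi ^~ w) = (fun_of_fin (model_data w).1)) //.
by apply/funext => x; rewrite ffunE.
Qed.

Lemma mpred_nth_sorted a b : mpred (fun w => nth 0%N (sorted_indices theta B s w L.+1) a = b).
Proof.
apply: eq_mpred (mfin_pred (fun z => nth 0%N (isort (pattern_rel z) L.+1) a = b)
   (mfin_pat model s_gt0 (L := L))) => w.
by rewrite sorted_indices_pattern.
Qed.

End Finite.

(* Measures are unspecified on non-measurable sets, so [outcome_changed] must be
   shown measurable although [perturb] is defined by a choice operator. *)
Lemma mpred_stabilizes : mpred (fun w => sorting_stabilizes (moved w)).
Proof.
have mle i j : mpred (fun w => moved w i <= moved w j).
  by apply: mpred_le; exact: (measurable_moved_time model).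
(* Injectivity becomes a countable conjunction, and the index is shifted to [n.+1] to match
   [pattern]. *)
apply: (@eq_mpred _ _ (fun w =>
  ((forall i j, i <> j -> ~ (moved w i <= moved w j /\ moved w j <= moved w i)) /\
   (forall a, exists b M, forall n, (M <= n)%N ->
      nth 0%N (sorted_indices theta B s w n.+1) a = b)) /\
   (forall k, exists a M, forall n, (M <= n)%N ->
      nth 0%N (sorted_indices theta B s w n.+1) a = k))).
  move=> w.
  have shift a b : (exists M, forall n, (M <= n)%N ->
      nth 0%N (sorted_indices theta B s w n.+1) a = b) <->
    (exists M, forall n, (M <= n)%N -> nth 0%N (isort (time_le (moved w)) n) a = b).
    split=> -[M h]; last by exists M => n Mn; apply: h; exact: leqW.
    by exists M.+1 => -[//|n] Mn; exact: h.
  split => [[[h1 h2] h3]|[h1 h2 h3]].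
    split.
    - move=> i j ij; apply: contrapT => nij; apply: (h1 i j nij).
      by rewrite /= ij lexx.
    - by move=> a; have [b /shift] := h2 a; exists b.
    - by move=> k; have [a /shift] := h3 k; exists a.
  split; first split.
  - by move=> i j nij /andP/le_anti/h1.
  - by move=> a; have [b /shift] := h2 a; exists b.
  - by move=> k; have [a /shift] := h3 k; exists a.
apply: mpred_and; first apply: mpred_and.
- apply: mpred_foralln => i; apply: mpred_foralln => j; apply: mpred_imp.
  by apply: mpred_not; apply: mpred_and.
- apply: mpred_foralln => a; apply: mpred_existsn => b; apply: mpred_existsn => M.
  by apply: mpred_foralln => n; apply: mpred_imp; exact: mpred_nth_sorted.
- apply: mpred_foralln => a; apply: mpred_existsn => b; apply: mpred_existsn => M.
  by apply: mpred_foralln => n; apply: mpred_imp; exact: mpred_nth_sorted.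
Qed.

Lemma mpred_consensus : mpred (fun w => consensus (xi ^~ w) (theta ^~ w)).
Proof.
apply: (@eq_mpred _ _ (fun w => exists N, forall k, (N <= k)%N -> forall v,
   run (xi ^~ w) (edge_list theta w k.+1) v)).
  by move=> w; split => [h|/(consensus_trueE v0)//]; apply/(consensus_trueE v0).
apply: mpred_existsn => N; apply: mpred_foralln => k; apply: mpred_imp.
by apply: mpred_forall_fin => v; exact: mpred_run.
Qed.

(** Where the order stabilizes, heads of the perturbed sequence are heads of long sorted lists;
    elsewhere the fallback leaves the original outcome. *)
Lemma mpred_consensus_perturb :
  mpred (fun w => consensus (xi ^~ w) (perturb theta B s w)).
Proof.
apply: (@eq_mpred _ _ (fun w => (sorting_stabilizes (moved w) /\
   exists N, forall k, (N <= k)%N -> exists M, forall n, (M <= n)%N -> forall v,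
   run (xi ^~ w) (take k.+1 [seq nth e0 (edge_list theta w n.+1) i |
      i <- sorted_indices theta B s w n.+1]) v) \/
   (~ sorting_stabilizes (moved w) /\ consensus (xi ^~ w) (theta ^~ w)))).
  move=> w.
  have [[sigma hs hp]|[ns hp]] := perturb_edges w; last first.
    have <- : consensus (xi ^~ w) (theta ^~ w) = consensus (xi ^~ w) (perturb theta B s w).
      by apply: (eq_consensus v0) => k; rewrite hp.
    split => [[[/increasing_enum_stabilizes //]|[]]//|c]; right; split => //.
    by move/increasing_enum_stabilizes.
  have st : sorting_stabilizes (moved w) by apply/increasing_enum_stabilizes; exists sigma.
  split=> [[[_ [N h]]|[]//]|].
    apply/(consensus_trueE v0); exists N => k Nk v.
    have [M1 h1] := h k Nk; have [M2 h2] := perturb_edge_list k.+1 hs hp.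
    by rewrite -(h2 (maxn M1 M2).+1) ?leqW ?leq_maxr //; apply: h1; exact: leq_maxl.
  move=> /(consensus_trueE v0)[N h]; left; split => //; exists N => k Nk.
  have [M2 h2] := perturb_edge_list k.+1 hs hp; exists M2 => n Mn v.
  by rewrite h2 ?leqW // h.
apply: mpred_or; apply: mpred_and.
- exact: mpred_stabilizes.
- apply: mpred_existsn => N; apply: mpred_foralln => k; apply: mpred_imp.
  apply: mpred_existsn => M; apply: mpred_foralln => n; apply: mpred_imp.
  by apply: mpred_forall_fin => v; exact: mpred_run_sorted.
- by apply: mpred_not; exact: mpred_stabilizes.
- exact: mpred_consensus.
Qed.

Lemma measurable_outcome_changed : measurable outcome_changed.
Proof.
have h1 := mfin_bool mpred_consensus; have h2 := mfin_bool mpred_consensus_perturb.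
exact: (mfin_pred (fun y : bool * bool => y.1 <> y.2) (mfin_pair h1 h2)).
Qed.

(** With [J] fixed, [pr_liminf] removes the truncation [L]; the error [2 * (X / J%:R)] from
    undecided runs then vanishes as [J] grows. *)
Lemma pr_outcome_changed : connected_graph G -> m * Num.sqrt s <= 1 ->
  pr P outcome_changed <=
  12 * inversion_const * #|V|%:R * (max_degree G)%:R * Num.sqrt s.
Proof.
move=> cG eps1; set bound := 12 * _ * _ * _ * _.
have V0 : (0 < #|V|)%N by apply/card_gt0P; exists v0.
pose X : R := m * (#|V| ^ 2)%:R / 2.
have X0 : 0 <= X by rewrite /X !mulr_ge0.
have H J : (0 < J)%N -> pr P outcome_changed <= bound + 2 * (X / J%:R).
  move=> J0.
  apply: (pr_liminf (A := fun L => differ_event theta B e0 s J L)).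
  - exact: measurable_outcome_changed.
  - by move=> L; exact: (measurable_differ_event model).
  - by move=> w; exact: outcome_changed_differ.
  - exists J => L JL; apply: le_trans (pr_differ_event model m_gt0 e0 s_gt0 (leqW JL) V0 eps1) _.
    rewrite addrC lerD2l ler_wpM2l // ler_pdivlMr ?ltr0n //.
    exact: mean_not_unanimous.
apply/ler_addgt0Pr => e e_gt0.
pose J := (Num.trunc (2 * X / e)).+1.
apply: (le_trans (H J isT)); rewrite lerD2l mulrA ler_pdivrMr ?ltr0n // [leRHS]mulrC.
have /truncn_itv/andP[_ /ltW] : 0 <= 2 * X / e by rewrite divr_ge0 ?mulr_ge0 // ltW.
by rewrite ler_pdivrMr.
Qed.

End NoiseSensitivity.

Theorem theorem1p9 (R : realType) (p : R) (hp : 0 < p < 1)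
    (c1 : R) (hc1 : 0 < c1) :
  exists c2 : R, 0 < c2 /\
    forall (n : nat) (V : finType) (G : sgraph V) (s : R)
      (d : measure_display) (T : measurableType d) (P : probability T R)
      (xi : V -> T -> bool) (theta : nat -> T -> dedge G * R)
      (B : nat -> R -> T -> R),
      (2 <= n)%N -> #|V| = n -> connected_graph G ->
      0 < s -> #|edges G|%:R * Num.sqrt s <= c1 ->
      noisy_voter_model P p xi theta B ->
      (P [set w | consensus (xi ^~ w) (theta ^~ w) <>
                  consensus (xi ^~ w) (perturb theta B s w)]
       <= (c2 * n%:R * (max_degree G)%:R * Num.sqrt s)%:E)%E.
Proof.
exists (12 * inversion_const); split; first by rewrite !mulr_gt0 ?expR_gt0.
move=> n V G s d T P xi theta B n2 Vn cG s0 _ model; subst n.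
(* With two vertices [id] is not unanimous, so connectedness provides a discordant edge. *)
have /card_gt0P[e0 _] : (0 < #|{: dedge G}|)%N.
  rewrite lt0n; apply/negP => /eqP E0.
  have : ~~ unanimous (id : V -> V).
    have /card_gt1P[x [y [_ _ xy]]] := n2.
    by apply: contra xy => /unanimousP h; rewrite (h x y).
  move=> /(discord_gt0 cG); rewrite /discord big1 // => e _.
  by move/card0_eq/(_ e): E0; rewrite inE.
have m0 : 0 < (#|{: dedge G}|%:R : R).
  by rewrite ltr0n; apply/card_gt0P; exists e0.
have mO := measurable_outcome_changed model e0 s0.
rewrite -/(outcome_changed xi theta B s) (prE P mO) lee_fin.
set C := 12 * inversion_const.
have C1 : 1 <= C.
  have := expR_ge1Dx (13 / 2 : R); rewrite /C /inversion_const; lra.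
have C0 : 0 <= C by exact: le_trans C1.
(* If this quantity exceeds 1, so does the claimed bound, as [C] is at least 1; otherwise it
   dominates the number of directed edges times [Num.sqrt s], by [card_dedge_le]. *)
have [le1|gt1] := leP (#|V|%:R * (max_degree G)%:R * Num.sqrt s) 1.
  apply: (pr_outcome_changed model m0 e0 s0 cG).
  apply: le_trans le1; rewrite ler_wpM2r ?sqrtr_ge0 // -natrM ler_nat.
  exact: card_dedge_le.
apply: (le_trans (pr_le1 P mO)); apply: (le_trans (ltW gt1)).
rewrite -!(mulrA C) ler_peMl // ?mulr_ge0 ?sqrtr_ge0 //.
Qed.
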